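(* Let $\Lambda=kQ/I$ be a bound quiver algebra. Then: (1) $\Lambda$ is of infinite co+ global dimension if and only if the $\tau$-Hochschild cohomology $\mathsf{HH}^*_\tau(\Lambda)=\mathsf{HH}^*_\tau(\Lambda,\Lambda)$ is infinite. (2) $\Lambda$ is of infinite + global dimension if and only if the $\tau$-Hochschild homology $\mathsf{HH}_*^\tau(\Lambda)=\mathsf{HH}_*^\tau(\Lambda,\Lambda)$ is infinite.
   Context: Let $k$ be a field. All modules and bimodules are finite dimensional over $k$; $D=\mathrm{Hom}_k(-,k)$; $\otimes=\otimes_k$. Bound quiver algebra: $Q$ is a finite quiver with vertex set $Q_0$ and arrow set $Q_1$, $F$ is the ideal of the path algebra $kQ$ spanned by all paths of positive length (generated by the arrows), $I$ is an admissible ideal ($F^m\subset I\subset F^2$ for some $m\ge 2$), and $\Lambda=kQ/I$. Paths are composed from right to left, so for vertices (idempotents) $x,y$ the space $y\Lambda x$ is spanned by the classes of paths from $x$ to $y$. For $x\in Q_0$, ${}_xk$ is the simple left $\Lambda$-module at $x$ and $k_x$ is the simple right $\Lambda$-module at $x$. A graded vector space $V_*$ is infinite if $V_n\neq 0$ for infinitely many $n$, and finite otherwise. $\Lambda$ has infinite + global dimension (resp. infinite co+ global dimension) if there is a pair of vertices $(y,x)$ with $y\Lambda x\neq 0$ and $\mathrm{Tor}^\Lambda_*(k_x,{}_yk)$ infinite (resp. $y\Lambda x\ne 0$ and $\mathrm{Tor}^\Lambda_*(k_y,{}_xk)$ infinite). $\tau$-Hochschild (co)homology: $\Lambda$-bimodules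 are left $\Lambda\otimes\Lambda^{\mathrm{op}}$-modules, and $\mathrm{Hom}_{\Lambda-\Lambda}$ denotes bimodule morphisms. $\Omega^{m}$ is the $m$-th syzygy of bimodules taken with minimal projective resolutions ($\Omega^0=\mathrm{id}$); $\mathrm{Tr}M$ is the transpose, i.e. the cokernel of $\mathrm{Hom}(P_0,\Lambda\otimes\Lambda^{\mathrm{op}})\to\mathrm{Hom}(P_1,\Lambda\otimes\Lambda^{\mathrm{op}})$ for a minimal projective presentation $P_1\to P_0\to M\to 0$; $\tau=D\,\mathrm{Tr}$ is the Auslander–Reiten translate for $\Lambda$-bimodules; $\tau_n=\tau\Omega^{n-1}$ for $n\ge1$. For a $\Lambda$-bimodule $X$ and $n\geq 1$: $\mathsf{HH}^n_\tau(\Lambda,X)=D\,\mathrm{Hom}_{\Lambda-\Lambda}(X,\tau_n\Lambda)$ and $\mathsf{HH}_n^\tau(\Lambda,X)=\mathrm{Hom}_{\Lambda-\Lambda}(DX,\tau_n\Lambda)$. *)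

(* Defs.v *)
From HB Require Import structures.
From mathcomp Require Import all_boot all_algebra all_field.
From mathcomp Require Import finmap monalg.
From mathcomp Require boolp.

Set Implicit Arguments.
Unset Strict Implicit.
Unset Printing Implicit Defensive.

Import GRing.Theory.
Local Open Scope ring_scope.

Record quiver := Quiver {
  vertex : finType;
  arrow : finType;
  source : arrow -> vertex;
  target : arrow -> vertex }.

(* [(x, [:: a1; ...; an])] is the path an ... a1 (composed from right to left)
   starting at x. *)
Section Paths.
Variable Q : quiver.

Definition is_path (p : vertex Q * seq (arrow Q)) :=
  map (@source Q) p.2 == belast p.1 (map (@target Q) p.2).

Definition qpath := {p : vertex Q * seq (arrow Q) | is_path p}.

Definition path_start (p : qpath) : vertex Q := (val p).1.
Definition path_arrows (p : qpath) : seq (arrow Q) := (val p).2.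
Definition path_end (p : qpath) : vertex Q :=
  last (path_start p) (map (@target Q) (path_arrows p)).
Definition path_length (p : qpath) : nat := size (path_arrows p).

Definition trivial_path (x : vertex Q) : qpath :=
  exist _ (x, [::]) (eqxx [::]).

(* The path "q after p"; it exists when p ends where q starts. *)
Definition path_comp (q p : qpath) : option qpath :=
  if path_end p == path_start q
  then insub (path_start p, path_arrows p ++ path_arrows q) else None.

Lemma path_compP q p (r : qpath) :
  path_comp q p = Some r <->
  path_end p = path_start q /\
  val r = (path_start p, path_arrows p ++ path_arrows q).
Proof.
rewrite /path_comp; split.
  case: eqP => // -> ; case: insubP => // u _ Hu [<-]; by split.
case=> -> Hr; rewrite eqxx -Hr valK //.
Qed.

Lemma path_comp_some q p :
  path_end p = path_start q -> exists r, path_comp q p = Some r.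
Proof.
move=> e; rewrite /path_comp e eqxx.
case: insubP => [u _ _|]; first by exists u.
rewrite /is_path /= map_cat map_cat belast_cat.
have /eqP Hp := valP p; have /eqP Hq := valP q.
by rewrite -!/(path_start _) -!/(path_arrows _) in Hp Hq *;
  rewrite Hp Hq -/(path_end p) e eqxx.
Qed.

Lemma path_end_comp q p r : path_comp q p = Some r ->
  path_end r = path_end q /\ path_start r = path_start p.
Proof.
case/path_compP=> e Hr; rewrite /path_end /path_start /path_arrows Hr /=.
by rewrite map_cat last_cat -/(path_end p) e.
Qed.

Lemma path_compA r q p :
  obind (path_comp r) (path_comp q p) =
  obind (fun s => path_comp s p) (path_comp r q).
Proof.
have [e1|n1] := eqVneq (path_end p) (path_start q); last first.
  have -> : path_comp q p = None by rewrite /path_comp (negbTE n1).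
  case E: (path_comp r q) => [s|] //=.
  have [_ es] := path_end_comp E.
  by rewrite /path_comp es (negbTE n1).
have [s Es] := path_comp_some e1; rewrite Es /=.
have [e2|n2] := eqVneq (path_end q) (path_start r); last first.
  have [es _] := path_end_comp Es.
  by rewrite /path_comp es (negbTE n2).
have [t Et] := path_comp_some e2; rewrite Et /=.
have [es _] := path_end_comp Es; have [_ et] := path_end_comp Et.
have [u Eu] : exists u, path_comp r s = Some u.
  by apply: path_comp_some; rewrite es.
rewrite Eu; apply/esym/path_compP; split; first by rewrite e1 et.
case/path_compP: Eu => _ ->; case/path_compP: Es => _ Hs.
case/path_compP: Et => _ Ht.
by rewrite /path_start /path_arrows Hs Ht /= catA.
Qed.

Lemma trivial_comp x p :
  path_comp (trivial_path x) p = if path_end p == x then Some p else None.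
Proof.
case: eqP => e.
  apply/path_compP; split=> //.
  by rewrite /path_arrows cats0; exact: surjective_pairing.
by rewrite /path_comp /path_start /=; case: eqP.
Qed.

Lemma comp_trivial x p :
  path_comp p (trivial_path x) = if x == path_start p then Some p else None.
Proof.
case: eqP => e.
  apply/path_compP; split=> //.
  by rewrite /= e; exact: surjective_pairing.
by rewrite /path_comp /path_end /=; case: eqP.
Qed.

Lemma path_comp_eq_trivial q p x :
  (path_comp q p == Some (trivial_path x)) =
  (q == trivial_path x) && (p == trivial_path x).
Proof.
apply/eqP/andP => [|[/eqP-> /eqP->]]; last by rewrite trivial_comp eqxx.
case/path_compP=> e /= [ex] /esym Hs.
have [sp sq] : path_arrows p = [::] /\ path_arrows q = [::].
  by case: (path_arrows p) (path_arrows q) Hs => [|? ?] [|? ?].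
have ep : path_end p = path_start p by rewrite /path_end sp.
split; apply/eqP/val_inj; rewrite /= [LHS]surjective_pairing.
  by rewrite -[(val q).1]/(path_start q) -[(val q).2]/(path_arrows q) -e ep ex sq.
by rewrite -[(val p).1]/(path_start p) -[(val p).2]/(path_arrows p) ex sp.
Qed.

End Paths.

Section PathAlgebra.
Variables (k : fieldType) (Q : quiver).

Definition path_algebra : Type := {malg k[qpath Q]}.
HB.instance Definition _ := GRing.Lmodule.copy path_algebra {malg k[qpath Q]}.

Definition pa_coef (p : qpath Q) (u : path_algebra) : k := mcoeff p u.
Fact pa_path_key : unit. Proof. by []. Qed.
Definition pa_path :=
  locked_with pa_path_key (fun p : qpath Q => mkmalgU p 1 : path_algebra).
Canonical pa_path_unlockable := [unlockable fun pa_path].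
Definition pa_opath (op : option (qpath Q)) : path_algebra :=
  if op is Some p then pa_path p else 0.

Definition pa_ext (V : lmodType k) (F : qpath Q -> V) (u : path_algebra) : V :=
  \sum_(p <- msupp (u : {malg k[qpath Q]})) pa_coef p u *: F p.

Definition pa_mul (u v : path_algebra) : path_algebra :=
  pa_ext (fun q => pa_ext (fun p => pa_opath (path_comp q p)) v) u.
Definition pa_one : path_algebra := \sum_(x : vertex Q) pa_path (trivial_path x).

Lemma pa_coef_is_linear p : linear (pa_coef p : _ -> k^o).
Proof. by move=> c u v; rewrite /pa_coef mcoeffD mcoeffZ. Qed.
HB.instance Definition _ p :=
  GRing.isLinear.Build k path_algebra k^o _ (pa_coef p) (pa_coef_is_linear p).

Lemma pa_coefD p u v : pa_coef p (u + v) = pa_coef p u + pa_coef p v.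
Proof. exact: mcoeffD. Qed.

Lemma pa_coefB p u v : pa_coef p (u - v) = pa_coef p u - pa_coef p v.
Proof. exact: mcoeffB. Qed.

Lemma pa_coef0 p : pa_coef p 0 = 0.
Proof. exact: mcoeff0. Qed.

Lemma pa_coef_sum (T : Type) (r : seq T) (P : pred T) (F : T -> path_algebra) p :
  pa_coef p (\sum_(i <- r | P i) F i) = \sum_(i <- r | P i) pa_coef p (F i).
Proof. exact: (big_morph _ (pa_coefD p) (pa_coef0 p)). Qed.

Lemma pa_coefE p q : pa_coef p (pa_path q) = (q == p)%:R.
Proof. by rewrite unlock /pa_coef mcoeffU. Qed.

Lemma pa_extE (V : lmodType k) (F : qpath Q -> V) (d : {fset qpath Q}) (u : path_algebra) :
  (msupp (u : {malg k[qpath Q]}) `<=` d)%fset ->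
  pa_ext F u = \sum_(p <- d) pa_coef p u *: F p.
Proof.
move=> sub; rewrite /pa_ext; apply: big_fset_incl => // p _ /mcoeff_outdom.
by rewrite /pa_coef => ->; rewrite scale0r.
Qed.

Lemma pa_ext_is_linear (V : lmodType k) (F : qpath Q -> V) : linear (pa_ext F).
Proof.
move=> c u v.
pose d := (msupp (u : {malg k[qpath Q]}) `|` msupp (v : {malg k[qpath Q]}))%fset.
have su : (msupp (u : {malg k[qpath Q]}) `<=` d)%fset by apply: fsubsetUl.
have sv : (msupp (v : {malg k[qpath Q]}) `<=` d)%fset by apply: fsubsetUr.
have suv : (msupp ((c *: u + v) : {malg k[qpath Q]}) `<=` d)%fset.
  apply: fsubset_trans (msuppD_le _ _) _; apply: fsetSU.
  exact: msuppZ_le.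
rewrite (pa_extE _ su) (pa_extE _ sv) (pa_extE _ suv) scaler_sumr -big_split /=.
by apply: eq_bigr => p _; rewrite linearP scalerDl scalerA.
Qed.
HB.instance Definition _ (V : lmodType k) (F : qpath Q -> V) :=
  GRing.isLinear.Build k path_algebra V _ (@pa_ext V F) (pa_ext_is_linear F).

Lemma pa_ext_path (V : lmodType k) (F : qpath Q -> V) p : pa_ext F (pa_path p) = F p.
Proof.
rewrite (@pa_extE _ _ [fset p]%fset); last by rewrite unlock msuppU_le.
by rewrite big_seq_fset1 pa_coefE eqxx scale1r.
Qed.

Lemma pa_extD (u : path_algebra) : u = pa_ext pa_path u.
Proof.
apply/malgP => q; rewrite /pa_ext.
pose S := msupp (u : {malg k[qpath Q]}).
transitivity (\sum_(p <- S) mcoeff q (mkmalgU p (mcoeff p (u : {malg k[qpath Q]})))).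
  rewrite -(raddf_sum (@mcoeff (qpath Q) k q)); congr (mcoeff q _).
  exact: monalgE.
transitivity (\sum_(p <- S) mcoeff q (pa_coef p u *: pa_path p)); last first.
  exact/esym/(raddf_sum (@mcoeff (qpath Q) k q)).
apply: eq_bigr => p _.
transitivity (pa_coef p u * pa_coef q (pa_path p)); last first.
  exact/esym/(@mcoeffZ (qpath Q) k).
by rewrite mcoeffU pa_coefE mulr_natr.
Qed.

Lemma pa_eq_lin (V : lmodType k) (f g : path_algebra -> V) :
  linear f -> linear g -> (forall p, f (pa_path p) = g (pa_path p)) -> f =1 g.
Proof.
move=> fl gl e u.
pose F : {linear path_algebra -> V} := HB.pack f (GRing.isLinear.Build _ _ _ _ f fl).
pose G : {linear path_algebra -> V} := HB.pack g (GRing.isLinear.Build _ _ _ _ g gl).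
rewrite -[f u]/(F u) -[g u]/(G u) [u]pa_extD /pa_ext !linear_sum.
by apply: eq_bigr => p _; rewrite !linearZ; congr (_ *: _); apply: e.
Qed.

Lemma pa_mul_linl v : linear (pa_mul^~ v).
Proof. by move=> c u u'; rewrite /pa_mul linearP. Qed.

Lemma pa_mul_linr u : linear (pa_mul u).
Proof.
move=> c v v'; rewrite /pa_mul /pa_ext scaler_sumr -big_split /=.
apply: eq_bigr => q _.
rewrite -/(pa_ext _ (c *: v + v')) -/(pa_ext _ v) -/(pa_ext _ v').
by rewrite (pa_ext_is_linear _ c v v') scalerDr !scalerA mulrC.
Qed.

Lemma pa_mul_path q p : pa_mul (pa_path q) (pa_path p) = pa_opath (path_comp q p).
Proof. by rewrite /pa_mul !pa_ext_path. Qed.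

Lemma lin_comp (U V W : lmodType k) (f : V -> W) (g : U -> V) :
  linear f -> linear g -> linear (fun x => f (g x)).
Proof. by move=> fl gl c x y; rewrite gl fl. Qed.

Lemma pa_mul0l v : pa_mul 0 v = 0.
Proof. by rewrite /pa_mul linear0. Qed.
Lemma pa_mul0r u : pa_mul u 0 = 0.
Proof. by rewrite /pa_mul /pa_ext big1 // => q _; rewrite msupp0 big_seq_fset0 scaler0. Qed.

Lemma pa_mulA : associative pa_mul.
Proof.
move=> u v w.
apply: (pa_eq_lin (f := fun u => pa_mul u (pa_mul v w))
                  (g := fun u => pa_mul (pa_mul u v) w)).
- exact: pa_mul_linl.
- exact: (lin_comp (pa_mul_linl w) (pa_mul_linl v)).
move=> r.
apply: (pa_eq_lin (f := fun v => pa_mul (pa_path r) (pa_mul v w))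
                  (g := fun v => pa_mul (pa_mul (pa_path r) v) w)).
- exact: (lin_comp (pa_mul_linr _) (pa_mul_linl w)).
- exact: (lin_comp (pa_mul_linl w) (pa_mul_linr _)).
move=> q.
apply: (pa_eq_lin (f := fun w => pa_mul (pa_path r) (pa_mul (pa_path q) w))
                  (g := fun w => pa_mul (pa_mul (pa_path r) (pa_path q)) w)).
- exact: (lin_comp (pa_mul_linr _) (pa_mul_linr _)).
- exact: pa_mul_linr.
move=> p; rewrite !pa_mul_path.
have -> (o : option (qpath Q)) :
    pa_mul (pa_path r) (pa_opath o) = pa_opath (obind (path_comp r) o).
  by case: o => [s|] /=; rewrite ?pa_mul_path ?pa_mul0r.
have -> (o : option (qpath Q)) :
    pa_mul (pa_opath o) (pa_path p) = pa_opath (obind (fun s => path_comp s p) o).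
  by case: o => [s|] /=; rewrite ?pa_mul_path ?pa_mul0l.
by rewrite path_compA.
Qed.

Lemma pa_mul1l : left_id pa_one pa_mul.
Proof.
move=> u; rewrite -[RHS]/(idfun u).
apply: (pa_eq_lin (f := pa_mul pa_one) (g := idfun)) => [|//|p].
  exact: pa_mul_linr.
rewrite /pa_mul /pa_one linear_sum /= (bigD1 (path_end p)) //=.
rewrite !pa_ext_path trivial_comp eqxx big1 ?addr0 // => x nx.
by rewrite !pa_ext_path trivial_comp eq_sym (negbTE nx).
Qed.

Lemma pa_mul1r : right_id pa_one pa_mul.
Proof.
move=> u; rewrite -[RHS]/(idfun u).
apply: (pa_eq_lin (f := pa_mul^~ pa_one) (g := idfun)) => [|//|p].
  exact: pa_mul_linl.
rewrite /pa_mul pa_ext_path /pa_one linear_sum /= (bigD1 (path_start p)) //=.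
rewrite !pa_ext_path comp_trivial eqxx big1 ?addr0 // => x nx.
by rewrite !pa_ext_path comp_trivial (negbTE nx).
Qed.

Lemma pa_mulDl : left_distributive pa_mul +%R.
Proof. by move=> u v w; have := pa_mul_linl w 1 u v; rewrite !scale1r. Qed.

Lemma pa_mulDr : right_distributive pa_mul +%R.
Proof. by move=> u v w; have := pa_mul_linr u 1 v w; rewrite !scale1r. Qed.

HB.instance Definition _ := GRing.Zmodule_isPzRing.Build path_algebra
  pa_mulA pa_mul1l pa_mul1r pa_mulDl pa_mulDr.

Lemma pa_coef_trivialM x (u v : path_algebra) :
  pa_coef (trivial_path x) (u * v) =
  pa_coef (trivial_path x) u * pa_coef (trivial_path x) v.
Proof.
apply: (pa_eq_lin (V := k^o) (f := fun u => pa_coef (trivial_path x) (u * v))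
  (g := fun u => pa_coef (trivial_path x) u * pa_coef (trivial_path x) v)).
- exact: (lin_comp (W := k^o) (pa_coef_is_linear _) (pa_mul_linl v)).
- by move=> c a b; rewrite linearP mulrDl; congr (_ + _); exact/esym/mulrA.
move=> q.
apply: (pa_eq_lin (V := k^o)
  (f := fun v => pa_coef (trivial_path x) (pa_path q * v))
  (g := fun v => pa_coef (trivial_path x) (pa_path q) * pa_coef (trivial_path x) v)).
- exact: (lin_comp (W := k^o) (pa_coef_is_linear _) (pa_mul_linr _)).
- by move=> c a b; rewrite linearP mulrDr; congr (_ + _); exact: mulrCA.
move=> p; rewrite !pa_coefE -natrM mulnb -path_comp_eq_trivial.
rewrite -[_ * _]/(pa_mul _ _) pa_mul_path.
by case: path_comp => [r|] /=; rewrite ?pa_coefE // linear0.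
Qed.

End PathAlgebra.

Lemma linfunE (k : fieldType) (U V : vectType k) (f : U -> V) :
  linear f -> linfun f =1 f.
Proof.
move=> fl u.
pose F : {linear U -> V} := HB.pack f (GRing.isLinear.Build _ _ _ _ f fl).
exact: (lfunE F).
Qed.

Lemma lin_comb (k : fieldType) (U V : lmodType k) c (f g : U -> V) :
  linear f -> linear g -> linear (fun x => c *: f x + g x).
Proof.
by move=> fl gl d x y; rewrite fl gl !scalerDr !scalerA addrACA mulrC.
Qed.

Section TensorSpace.
Variables (k : fieldType) (U V : vectType k).

(* U (x) V, in coordinates with respect to the bases [vbasis] of U and V. *)
Definition tens : vectType k := 'M[k]_(\dim {:U}, \dim {:V}).
Definition tpure (u : U) (v : V) : tens :=
  \matrix_(i, j) (coord (vbasis {:U}) i u * coord (vbasis {:V}) j v).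

(* The linear map U (x) V -> W induced by a bilinear map b. *)
Definition tlift (W : vectType k) (b : U -> V -> W) (t : tens) : W :=
  \sum_i \sum_j (t : 'M[k]_(\dim {:U}, \dim {:V})) i j *:
    b (vbasis {:U})`_i (vbasis {:V})`_j.

Definition bilin (W : lmodType k) (b : U -> V -> W) :=
  (forall v, linear (b^~ v)) /\ (forall u, linear (b u)).

Lemma tpure_bilin : bilin tpure.
Proof.
split=> [v|u] c x y; apply/matrixP => i j; rewrite !mxE linearP /=.
  by rewrite mulrDl mulrA.
by rewrite mulrDr mulrCA.
Qed.

Lemma tlift_is_linear (W : vectType k) (b : U -> V -> W) : linear (@tlift W b).
Proof.
move=> c s t; rewrite /tlift scaler_sumr -big_split; apply: eq_bigr => i _ /=.
rewrite scaler_sumr -big_split; apply: eq_bigr => j _ /=.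
by rewrite !mxE scalerDl scalerA.
Qed.
HB.instance Definition _ (W : vectType k) (b : U -> V -> W) :=
  GRing.isLinear.Build k tens W _ (@tlift W b) (tlift_is_linear b).

Lemma bilin_coord (W : lmodType k) (b : U -> V -> W) u v : bilin b ->
  b u v = \sum_i \sum_j (coord (vbasis {:U}) i u * coord (vbasis {:V}) j v) *:
    b (vbasis {:U})`_i (vbasis {:V})`_j.
Proof.
case=> bl br.
pose L v : {linear U -> W} := HB.pack (b^~ v) (GRing.isLinear.Build _ _ _ _ _ (bl v)).
pose R u : {linear V -> W} := HB.pack (b u) (GRing.isLinear.Build _ _ _ _ _ (br u)).
rewrite {1}(coord_vbasis (memvf u)) -[LHS]/(L v _) linear_sum.
apply: eq_bigr => i _; rewrite linearZ /= {1}(coord_vbasis (memvf v)).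
rewrite -[b _ _]/(R (vbasis {:U})`_i _) linear_sum scaler_sumr.
by apply: eq_bigr => j _; rewrite linearZ scalerA.
Qed.

Lemma tlift_pure (W : vectType k) (b : U -> V -> W) u v :
  bilin b -> tlift b (tpure u v) = b u v.
Proof.
move=> bb; rewrite (bilin_coord _ _ bb); apply: eq_bigr => i _; apply: eq_bigr => j _.
by rewrite mxE.
Qed.

Lemma coord_vbasis_nth (T : vectType k) (i j : 'I_(\dim {:T})) :
  coord (vbasis {:T}) i (vbasis {:T})`_j = (i == j)%:R.
Proof. by rewrite coord_free ?(basis_free (vbasisP _)) // eq_sym. Qed.

Lemma tens_eq_lin (W : lmodType k) (f g : tens -> W) :
  linear f -> linear g -> (forall u v, f (tpure u v) = g (tpure u v)) -> f =1 g.
Proof.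
move=> fl gl e t.
pose F : {linear tens -> W} := HB.pack f (GRing.isLinear.Build _ _ _ _ f fl).
pose G : {linear tens -> W} := HB.pack g (GRing.isLinear.Build _ _ _ _ g gl).
rewrite -[f t]/(F t) -[g t]/(G t).
rewrite [t](matrix_sum_delta (t : 'M[k]_(_, _))) !linear_sum; apply: eq_bigr => i _.
rewrite !linear_sum; apply: eq_bigr => j _; rewrite !linearZ; congr (_ *: _).
have -> : delta_mx i j = tpure (vbasis {:U})`_i (vbasis {:V})`_j.
  apply/matrixP => i' j'.
  by rewrite !mxE !coord_vbasis_nth -natrM mulnb eq_sym.
exact: e.
Qed.

End TensorSpace.

Section QuotientSpace.
Variables (k : fieldType) (V : vectType k) (U : {vspace V}).

(* V / U, realized on the chosen complement of U. *)
Definition quot : vectType k := subvs_of (U^C)%VS.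
Fact qproj_key : unit. Proof. by []. Qed.
Definition qproj : 'Hom(V, quot) :=
  locked_with qproj_key (linfun (vsproj (U^C)%VS) \o daddv_pi (U^C) U)%VF.
Canonical qproj_unlockable := [unlockable of qproj].
Definition qrepr : quot -> V := vsval.

Lemma qprojK w : qproj (qrepr w) = w.
Proof.
rewrite [qproj]unlock comp_lfunE lfunE /= daddv_pi_id ?vsvalK ?subvsP //.
by rewrite capvC capv_compl.
Qed.

Lemma lker_qproj : lker qproj = U.
Proof.
apply/vspaceP => v; rewrite memv_ker [qproj]unlock comp_lfunE lfunE /=.
have d : (U^C :&: U = 0)%VS by rewrite capvC capv_compl.
have e : daddv_pi (U^C) U v + daddv_pi U (U^C) v = v.
  by apply: daddv_pi_add => //; rewrite addvC addv_complf memvf.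
apply/eqP/idP => [/(congr1 vsval)|Uv].
  rewrite vsprojK ?memv_pi // linear0 => e0.
  by rewrite -e e0 add0r memv_pi.
have e2 : daddv_pi U (U^C) v = v by apply: daddv_pi_id => //; rewrite capv_compl.
by move: e; rewrite e2 => /(canRL (addrK v)) ->; rewrite subrr linear0.
Qed.

Lemma qprojP v w : qproj v = qproj w <-> v - w \in U.
Proof.
have -> : (v - w \in U) = (qproj v == qproj w).
  by rewrite -[in LHS]lker_qproj memv_ker linearB subr_eq0.
by split=> [->|/eqP].
Qed.

Lemma qreprK v : v - qrepr (qproj v) \in U.
Proof. by apply/qprojP; rewrite qprojK. Qed.

End QuotientSpace.

Section Modules.
Variables (k : fieldType) (A : falgType k).

Record lmodule := LModule {
  lcar :> vectType k;
  lact : A -> 'End(lcar);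
  lact_linear : linear lact;
  lact1 : lact 1 = \1%VF;
  lactM : forall a b, lact (a * b) = (lact a \o lact b)%VF }.

Record rmodule := RModule {
  rcar :> vectType k;
  ract : A -> 'End(rcar);
  ract_linear : linear ract;
  ract1 : ract 1 = \1%VF;
  ractM : forall a b, ract (a * b) = (ract b \o ract a)%VF }.

Lemma lact1E (M : lmodule) (m : M) : lact M 1 m = m.
Proof. by rewrite lact1 id_lfunE. Qed.
Lemma lactME (M : lmodule) a b (m : M) : lact M (a * b) m = lact M a (lact M b m).
Proof. by rewrite lactM comp_lfunE. Qed.
Lemma lactPE (M : lmodule) c a b (m : M) :
  lact M (c *: a + b) m = c *: lact M a m + lact M b m.
Proof. by rewrite lact_linear add_lfunE scale_lfunE. Qed.
Lemma ract1E (M : rmodule) (m : M) : ract M 1 m = m.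
Proof. by rewrite ract1 id_lfunE. Qed.
Lemma ractME (M : rmodule) a b (m : M) : ract M (a * b) m = ract M b (ract M a m).
Proof. by rewrite ractM comp_lfunE. Qed.
Lemma ractPE (M : rmodule) c a b (m : M) :
  ract M (c *: a + b) m = c *: ract M a m + ract M b m.
Proof. by rewrite ract_linear add_lfunE scale_lfunE. Qed.

Definition lhom (M N : lmodule) (f : 'Hom(M, N)) :=
  forall a m, f (lact M a m) = lact N a (f m).

Definition lhom_defect (M N : lmodule) (a : A) (f : 'Hom(M, N)) : 'Hom(M, N) :=
  ((f \o lact M a) - (lact N a \o f))%VF.
Definition lhoms (M N : lmodule) : {vspace 'Hom(M, N)} :=
  (\bigcap_(i < \dim {:A}) lker (linfun (@lhom_defect M N (vbasis {:A})`_i)))%VS.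

Lemma lhom_defect_linear (M N : lmodule) a : linear (@lhom_defect M N a).
Proof.
move=> c f g; apply/lfunP => m.
by rewrite /lhom_defect !lfun_simp linearP scalerBr opprD addrACA.
Qed.

Lemma lact_coord (M : lmodule) a :
  lact M a = \sum_(i < \dim {:A}) coord (vbasis {:A}) i a *: lact M (vbasis {:A})`_i.
Proof.
pose L : {linear A -> 'End(M)} := HB.pack (lact M) (GRing.isLinear.Build _ _ _ _ _ (lact_linear M)).
rewrite -[lact M a]/(L a) {1}(coord_vbasis (memvf a)) linear_sum.
by apply: eq_bigr => i _; rewrite linearZ.
Qed.

Lemma lhomsP (M N : lmodule) (f : 'Hom(M, N)) : reflect (lhom f) (f \in lhoms M N).
Proof.
rewrite memvE; apply: (iffP subv_bigcapP) => [H a m|H i _].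
  rewrite !lact_coord !sum_lfunE linear_sum; apply: eq_bigr => i _.
  rewrite !scale_lfunE linearZ; congr (_ *: _).
  have := H i isT; rewrite -memvE memv_ker linfunE; last exact: lhom_defect_linear.
  move/eqP/lfunP/(_ m); rewrite /lhom_defect !lfun_simp => /eqP.
  by rewrite subr_eq0 => /eqP.
rewrite -memvE memv_ker linfunE; last exact: lhom_defect_linear.
by apply/eqP/lfunP => m; rewrite /lhom_defect !lfun_simp H subrr.
Qed.
End Modules.

Section ProjectiveCovers.
Variables (k : fieldType) (A : falgType k).
Implicit Types M N P : lmodule A.

Definition lstable M (U : {vspace M}) := forall a m, m \in U -> lact M a m \in U.

Definition projective P :=
  forall M N (g : 'Hom(M, N)) (f : 'Hom(P, N)),
    lhom g -> limg g = fullv -> lhom f -> exists2 h : 'Hom(P, M), lhom h & f = (g \o h)%VF.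

Definition superfluous M (U : {vspace M}) :=
  forall V : {vspace M}, lstable V -> (V + U = fullv)%VS -> V = fullv.

Record proj_cover M := ProjCover {
  pc_obj :> lmodule A;
  pc_map : 'Hom(pc_obj, M);
  pc_hom : lhom pc_map;
  pc_surj : limg pc_map = fullv;
  pc_projective : projective pc_obj;
  pc_superfluous : superfluous (lker pc_map) }.

Lemma lhom_comp M N P (g : 'Hom(N, P)) (f : 'Hom(M, N)) :
  lhom g -> lhom f -> lhom (g \o f)%VF.
Proof. by move=> hg hf a m; rewrite 2!comp_lfunE hf hg. Qed.

Section Submodule.
Variables (M : lmodule A) (U : {vspace M}) (stU : lstable U).

Definition sub_act a : 'End(subvs_of U) :=
  (linfun (vsproj U) \o lact M a \o linfun (@vsval k M U))%VF.

Lemma sub_actE a w : vsval (sub_act a w) = lact M a (vsval w).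
Proof. by rewrite /sub_act !comp_lfunE !lfunE /= vsprojK //; apply/stU/subvsP. Qed.

Lemma sub_act_linear : linear sub_act.
Proof.
move=> c a b; apply/lfunP => w; apply: subvs_inj.
by rewrite add_lfunE scale_lfunE linearP /= !sub_actE lactPE.
Qed.
Lemma sub_act1 : sub_act 1 = \1%VF.
Proof. by apply/lfunP => w; apply: subvs_inj; rewrite sub_actE lact1E id_lfunE. Qed.
Lemma sub_actM a b : sub_act (a * b) = (sub_act a \o sub_act b)%VF.
Proof. by apply/lfunP => w; apply: subvs_inj; rewrite comp_lfunE !sub_actE lactME. Qed.

Definition submodule : lmodule A := LModule sub_act_linear sub_act1 sub_actM.

Definition sub_incl : 'Hom(submodule, M) := linfun (@vsval k M U).
Lemma sub_inclE w : sub_incl w = vsval w.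
Proof. by rewrite /sub_incl lfunE. Qed.
Lemma sub_incl_hom : lhom sub_incl.
Proof. by move=> a w; rewrite !sub_inclE; apply: sub_actE. Qed.
End Submodule.

Section FreeModule.
Variable V : vectType k.

Definition free_act (a : A) : 'End(tens A V) :=
  linfun (tlift (fun b v => tpure (a * b) v)).

Lemma free_bilin (a : A) : bilin (fun (b : A) (v : V) => tpure (a * b) v).
Proof.
have [bl br] := @tpure_bilin k A V.
by split=> [v|b] c x y; rewrite ?br // mulrDr -scalerAr bl.
Qed.

Lemma free_actE a b v : free_act a (tpure b v) = tpure (a * b) v.
Proof. by rewrite lfunE /= tlift_pure //; apply: free_bilin. Qed.

Lemma lfun_tens_eq (U1 U2 W : vectType k) (f g : 'Hom(tens U1 U2, W)) :
  (forall u v, f (tpure u v) = g (tpure u v)) -> f = g.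
Proof. by move=> e; apply/lfunP/tens_eq_lin => //; apply: linearP. Qed.

Lemma free_act_linear : linear free_act.
Proof.
move=> c a b; apply: lfun_tens_eq => x v.
rewrite add_lfunE scale_lfunE !free_actE mulrDl -scalerAl.
by have [bl _] := @tpure_bilin k A V; rewrite bl.
Qed.
Lemma free_act1 : free_act 1 = \1%VF.
Proof. by apply: lfun_tens_eq => x v; rewrite free_actE mul1r id_lfunE. Qed.
Lemma free_actM a b : free_act (a * b) = (free_act a \o free_act b)%VF.
Proof. by apply: lfun_tens_eq => x v; rewrite comp_lfunE !free_actE mulrA. Qed.

Definition free_module : lmodule A := LModule free_act_linear free_act1 free_actM.

Lemma lact_bilin M (s : V -> M) : linear s -> bilin (fun a v => lact M a (s v)).
Proof.
move=> sl; split=> [v|a] c x y; first exact: lactPE.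
by rewrite sl linearP.
Qed.

Lemma free_ext_hom M (s : V -> M) : linear s ->
  lhom (linfun (tlift (fun a v => lact M a (s v))) : 'Hom(free_module, M)).
Proof.
move=> sl a; have bb := lact_bilin sl.
set F := linfun _.
have e : (F \o free_act a = lact M a \o F)%VF.
  apply: lfun_tens_eq => x v.
  by rewrite !comp_lfunE free_actE !lfunE /= !tlift_pure // lactME.
by move=> m; rewrite -[LHS]comp_lfunE e comp_lfunE.
Qed.

Lemma free_projective : projective free_module.
Proof.
move=> M N g f hg sg hf.
pose s v := (g^-1)%VF (f (tpure 1 v)).
have sl : linear s.
  move=> c x y; rewrite /s.
  by have [_ br] := @tpure_bilin k A V; rewrite br !linearP.
exists (linfun (tlift (fun a v => lact M a (s v)))); first exact: free_ext_hom.
apply: lfun_tens_eq => a v; rewrite comp_lfunE lfunE /= tlift_pure; last exact: lact_bilin.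
by rewrite hg limg_lfunVK ?sg ?memvf // -hf /= free_actE mulr1.
Qed.
End FreeModule.

Lemma has_projective M : exists P (f : 'Hom(P, M)),
  [/\ lhom f, limg f = fullv & projective P].
Proof.
pose f : 'Hom(free_module M, M) := linfun (tlift (fun a m => lact M a (idfun m))).
exists (free_module M), f.
have il : linear (@idfun M) by [].
split; [exact: free_ext_hom | | exact: free_projective].
apply/vspaceP => m; rewrite memvf; apply/memv_imgP; exists (tpure 1 m).
  exact: memvf.
by rewrite lfunE /= tlift_pure ?lact1E //; apply: (lact_bilin il).
Qed.

Lemma min_ex (p : nat -> Prop) : (exists n, p n) ->
  exists2 n, p n & forall m, p m -> (n <= m)%N.
Proof.
case=> n pn; pose q m := boolp.asbool (p m).
have exq : exists m, q m by exists n; apply/boolp.asboolP.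
case: (ex_minnP exq) => m /boolp.asboolP pm mm; exists m => // j pj.
by apply: mm; apply/boolp.asboolP.
Qed.

Lemma img_stable M N (f : 'Hom(M, N)) : lhom f -> lstable (limg f).
Proof.
move=> hf a _ /memv_imgP[m _ ->]; rewrite -hf; exact/memv_img/memvf.
Qed.
Lemma ker_stable M N (f : 'Hom(M, N)) : lhom f -> lstable (lker f).
Proof. by move=> hf a m; rewrite !memv_ker hf => /eqP->; rewrite linear0. Qed.

Lemma proj_cover_exists M : exists C : proj_cover M, True.
Proof.
pose good n := exists P (f : 'Hom(P, M)),
  [/\ lhom f, limg f = fullv, projective P & \dim {:P} = n].
have [|n [P [f [hf sf pP dP]]] minn] := @min_ex good.
  by have [P [f [? ? ?]]] := has_projective M; exists (\dim {:P}), P, f.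
have endo (phi : 'Hom(P, P)) : lhom phi -> (f \o phi = f)%VF -> limg phi = fullv.
  move=> hphi fphi.
  pose rk r := exists2 psi : 'Hom(P, P), lhom psi /\ (f \o psi = f)%VF &
                 \dim (limg psi) = r.
  have [|r [psi [hpsi fpsi] dpsi] minr] := @min_ex rk.
    by exists (\dim (limg phi)), phi.
  suff psifull : limg psi = fullv.
    apply/eqP; rewrite eqEdim subvf /= -{1}psifull dpsi; apply: minr.
    by exists phi.
  pose U := limg psi; pose S := submodule (img_stable hpsi).
  pose i : 'Hom(S, P) := sub_incl (img_stable hpsi).
  pose p : 'Hom(P, S) := (linfun (vsproj U) \o psi)%VF.
  have hi : lhom i by apply: sub_incl_hom.
  have ip x : i (p x) = psi x.
    by rewrite /p comp_lfunE sub_inclE lfunE /= vsprojK // memv_img ?memvf.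
  have inj_i : injective i by move=> x y; rewrite !sub_inclE; apply: subvs_inj.
  have hp : lhom p by move=> a m; apply: inj_i; rewrite hi !ip hpsi.
  clearbody p.
  have psi2 : (psi @: U = U)%VS.
    apply/eqP; rewrite eqEdim; apply/andP; split; first exact/limgS/subvf.
    rewrite dpsi -(limg_comp psi psi); apply: minr; exists (psi \o psi)%VF => //.
    split; first exact: lhom_comp.
    by rewrite comp_lfunA !fpsi.
  pose q : 'Hom(S, S) := (p \o i)%VF.
  have hq : lhom q by exact: lhom_comp.
  have kq : lker q == 0%VS.
    have : \dim (limg q) = \dim {:S}.
      apply/eqP; rewrite eqn_leq dimvS ?subvf //=.
      have : (fullv <= limg q)%VS.
        apply/subvP => w _; have : vsval w \in (psi @: U)%VS by rewrite psi2 subvsP.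
        case/memv_imgP => u Uu eu; apply/memv_imgP; exists (vsproj U u).
          exact: memvf.
        apply: inj_i; rewrite comp_lfunE ip !sub_inclE vsprojK //.
      exact: dimvS.
    have := limg_ker_dim q fullv; rewrite capfv => <- /eqP.
    by rewrite -{1}[\dim (limg q)]add0n eqn_add2r eq_sym dimv_eq0.
  pose q1 := (q^-1)%VF : 'Hom(S, S).
  have q1K x : q1 (q x) = x by apply: lker0_lfunK.
  have qK x : q (q1 x) = x by apply: lker0_lfunVK.
  have hq1 : lhom q1.
    by move=> a m; rewrite -{1}[m]qK -hq q1K.
  have pS : projective S.
    move=> X Y g h hg sg hh.
    have hhp : lhom (h \o p)%VF by exact: lhom_comp.
    have [l hl el] := pP X Y g (h \o p)%VF hg sg hhp.
    exists (l \o i \o q1)%VF; first exact: lhom_comp (lhom_comp hl hi) hq1.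
    apply/lfunP => x; rewrite !comp_lfunE -[g _]comp_lfunE -el comp_lfunE.
    by rewrite -[p _]comp_lfunE -/q qK.
  apply/eqP; rewrite eqEdim subvf dP.
  have -> : \dim (limg psi) = \dim {:S} by rewrite dimvf.
  apply: minn; exists S, (f \o i)%VF; split=> //.
    exact: lhom_comp.
  apply/eqP; rewrite eqEsubv subvf -sf /=; apply/subvP => _ /memv_imgP[x _ ->].
  apply/memv_imgP; exists (p x); first exact: memvf.
  by rewrite -{1}fpsi !comp_lfunE ip.
suff sup : superfluous (lker f).
  by exists (ProjCover hf sf pP sup).
move=> V stV VK; pose S := submodule stV.
pose i : 'Hom(S, P) := sub_incl stV.
have hi : lhom i by apply: sub_incl_hom.
have hfi : lhom (f \o i)%VF by exact: lhom_comp.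
have sfi : limg (f \o i)%VF = fullv.
  apply/vspaceP => m; rewrite memvf.
  have : m \in limg f by rewrite sf memvf.
  case/memv_imgP => x _ ->.
  have : x \in (V + lker f)%VS by rewrite VK memvf.
  case/memv_addP => v Vv [w]; rewrite memv_ker => /eqP fw ->.
  apply/memv_imgP; exists (vsproj V v); first exact: memvf.
  by rewrite linearD /= fw addr0 comp_lfunE sub_inclE vsprojK.
have [l hl el] := pP S M (f \o i)%VF f hfi sfi hf.
have e : limg (i \o l)%VF = fullv.
  apply: endo; first exact: lhom_comp.
  by rewrite comp_lfunA -el.
apply/eqP; rewrite eqEsubv subvf -e; apply/subvP => _ /memv_imgP[x _ ->].
by rewrite comp_lfunE sub_inclE subvsP.
Qed.

Definition pcover M : proj_cover M := projT1 (boolp.cid (proj_cover_exists M)).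

End ProjectiveCovers.
Arguments pc_hom {k A M} p.
Arguments pc_projective {k A M} p.
Arguments pc_superfluous {k A M} p.
Arguments sub_incl_hom {k A M U} stU.

Section Homological.
Variables (k : fieldType) (A : falgType k).
Implicit Types M N P : lmodule A.

Definition Omega M : lmodule A := submodule (ker_stable (pc_hom (pcover M))).
Definition syzygy (n : nat) M : lmodule A := iter n Omega M.

(* P1 -> P0 in the minimal projective presentation P1 -> P0 -> M -> 0, where
   P0 covers M and P1 covers the kernel of P0 -> M. *)
Definition pres_map M : 'Hom(pcover (Omega M), pcover M) :=
  (sub_incl (ker_stable (pc_hom (pcover M))) \o pc_map (pcover (Omega M)))%VF.

Lemma pres_map_hom M : lhom (pres_map M).
Proof. exact: lhom_comp (sub_incl_hom _) (pc_hom _). Qed.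

Definition min_res_term M (n : nat) : lmodule A := pcover (syzygy n M).
Definition min_res_diff M (n : nat) : 'Hom(min_res_term M n.+1, min_res_term M n) :=
  pres_map (syzygy n M).

Definition dualsp (V : vectType k) : vectType k := 'Hom(V, k^o).

Section RightDual.
Variable N : rmodule A.

Definition rdual_act a : 'End(dualsp N) :=
  linfun (fun f : dualsp N => (f \o ract N a)%VF : dualsp N).

Lemma rdual_actE a f n : (rdual_act a f : 'Hom(N, k^o)) n = (f : 'Hom(N, k^o)) (ract N a n).
Proof.
rewrite /rdual_act linfunE ?comp_lfunE // => c g h.
by apply/lfunP => m; rewrite !lfun_simp.
Qed.

Lemma rdual_linear : linear rdual_act.
Proof.
move=> c a b; apply/lfunP => f; apply/lfunP => n.
by rewrite rdual_actE ractPE !lfun_simp !rdual_actE linearP.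
Qed.
Lemma rdual_act1 : rdual_act 1 = \1%VF.
Proof. by apply/lfunP => f; apply/lfunP => n; rewrite rdual_actE ract1E id_lfunE. Qed.
Lemma rdual_actM a b : rdual_act (a * b) = (rdual_act a \o rdual_act b)%VF.
Proof. by apply/lfunP => f; apply/lfunP => n; rewrite comp_lfunE !rdual_actE ractME. Qed.

Definition rdual : lmodule A := LModule rdual_linear rdual_act1 rdual_actM.
End RightDual.

Section RightQuotient.
Variables (N : rmodule A) (U : {vspace N}).
Hypothesis stU : forall a n, n \in U -> ract N a n \in U.

Definition rquot_act a : 'End(quot U) :=
  (qproj U \o ract N a \o linfun (@vsval k N (U^C)))%VF.

Lemma rquot_actE a n : rquot_act a (qproj U n) = qproj U (ract N a n).
Proof.
rewrite /rquot_act !comp_lfunE lfunE; apply/qprojP.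
rewrite -linearB /=; apply: stU; rewrite -opprB memvN; exact: qreprK.
Qed.

Lemma rquot_linear : linear rquot_act.
Proof.
move=> c a b; apply/lfunP => w; rewrite -[w]qprojK.
by rewrite add_lfunE scale_lfunE !rquot_actE ractPE linearP.
Qed.
Lemma rquot_act1 : rquot_act 1 = \1%VF.
Proof. by apply/lfunP => w; rewrite -[w]qprojK rquot_actE ract1E id_lfunE. Qed.
Lemma rquot_actM a b : rquot_act (a * b) = (rquot_act b \o rquot_act a)%VF.
Proof. by apply/lfunP => w; rewrite -[w]qprojK comp_lfunE !rquot_actE ractME. Qed.

Definition rquotient : rmodule A := RModule rquot_linear rquot_act1 rquot_actM.
End RightQuotient.

Lemma lreg_linear : linear (@amull k A).
Proof. exact: linearP. Qed.
Lemma lregM (a b : A) : amull (a * b) = (amull a \o amull b)%VF.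
Proof. by apply/lfunP => x; rewrite comp_lfunE !lfunE /= mulrA. Qed.
Definition lregular : lmodule A := LModule lreg_linear (amull1 A) lregM.

(* Hom_A(P, A), a right A-module through the right multiplication of A. *)
Section HomRegular.
Variable P : lmodule A.

Lemma hom_reg_stable a (f : 'Hom(P, lregular)) :
  lhom f -> lhom (amulr a \o f : 'Hom(P, lregular))%VF.
Proof. by move=> hf b p; rewrite !comp_lfunE hf /= !lfunE /= mulrA. Qed.

Definition hom_reg_act a : 'End(subvs_of (lhoms P lregular)) :=
  linfun (fun f => vsproj (lhoms P lregular) (amulr a \o vsval f)%VF).

Lemma hom_reg_actE a f p :
  (vsval (hom_reg_act a f) : 'Hom(P, lregular)) p = (vsval f p : A) * a.
Proof.
rewrite /hom_reg_act linfunE.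
  rewrite vsprojK ?comp_lfunE ?lfunE //.
  by apply/lhomsP/hom_reg_stable/lhomsP/subvsP.
move=> c g h; rewrite -linearP; congr (vsproj _ _).
by apply/lfunP => q; rewrite !lfun_simp linearP.
Qed.

Lemma hom_reg_eq (f g : subvs_of (lhoms P lregular)) :
  (forall p, vsval f p = vsval g p) -> f = g.
Proof. by move=> e; apply/subvs_inj/lfunP. Qed.

Lemma hom_reg_linear : linear hom_reg_act.
Proof.
move=> c a b; apply/lfunP => f; apply: hom_reg_eq => p.
rewrite hom_reg_actE add_lfunE scale_lfunE linearP /= add_lfunE scale_lfunE.
by rewrite !hom_reg_actE mulrDr scalerAr.
Qed.
Lemma hom_reg_act1 : hom_reg_act 1 = \1%VF.
Proof. by apply/lfunP => f; apply: hom_reg_eq => p; rewrite hom_reg_actE mulr1 id_lfunE. Qed.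
Lemma hom_reg_actM a b : hom_reg_act (a * b) = (hom_reg_act b \o hom_reg_act a)%VF.
Proof.
by apply/lfunP => f; apply: hom_reg_eq => p; rewrite comp_lfunE !hom_reg_actE mulrA.
Qed.

Definition hom_reg : rmodule A := RModule hom_reg_linear hom_reg_act1 hom_reg_actM.
End HomRegular.

(* Hom_A(d, A) : Hom_A(N, A) -> Hom_A(M, A). *)
Definition hom_reg_map M N (d : 'Hom(M, N)) : 'Hom(hom_reg N, hom_reg M) :=
  linfun (fun f : hom_reg N => vsproj (lhoms M lregular) (vsval f \o d)%VF : hom_reg M).

Lemma hom_reg_mapE M N (d : 'Hom(M, N)) (f : hom_reg N) m : lhom d ->
  vsval (hom_reg_map d f) m = vsval f (d m).
Proof.
move=> hd; rewrite /hom_reg_map linfunE.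
  rewrite vsprojK ?comp_lfunE //.
  by apply/lhomsP/lhom_comp => //; apply/lhomsP/subvsP.
move=> c g h; rewrite -linearP; congr (vsproj _ _).
by apply/lfunP => q; rewrite !lfun_simp.
Qed.

Lemma hom_reg_map_stable M N (d : 'Hom(M, N)) : lhom d ->
  forall a f, f \in limg (hom_reg_map d) -> ract (hom_reg M) a f \in limg (hom_reg_map d).
Proof.
move=> hd a _ /memv_imgP[f _ ->]; apply/memv_imgP.
exists (ract (hom_reg N) a f); first exact: memvf.
by apply: hom_reg_eq => m; rewrite hom_reg_mapE // !hom_reg_actE hom_reg_mapE.
Qed.

Definition Tr M : rmodule A := rquotient (hom_reg_map_stable (@pres_map_hom M)).

Definition tau M : lmodule A := rdual (Tr M).
(* Only meaningful for n >= 1. *)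
Definition tau_n (n : nat) M : lmodule A := tau (syzygy n.-1 M).

Definition Hom_space M N : vectType k := subvs_of (lhoms M N).

(* R (x)_A N *)
Definition tens_rel (R : rmodule A) N : {vspace tens R N} :=
  (\sum_(a <- vbasis {:A}) \sum_(r <- vbasis {:R}) \sum_(n <- vbasis {:N})
     <[(tpure (ract R a r) n - tpure r (lact N a n) : tens R N)]>)%VS.
Definition tensA (R : rmodule A) N : vectType k := quot (tens_rel R N).
Definition tensA_map (R : rmodule A) M N (f : 'Hom(M, N)) :
    'Hom(tensA R M, tensA R N) :=
  (qproj (tens_rel R N) \o linfun (tlift (fun r m => tpure r (f m) : tens R N))
    \o linfun (@qrepr k _ (tens_rel R M)))%VF.

Definition homology (U V W : vectType k) (f : 'Hom(U, V)) (g : 'Hom(V, W)) :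
    vectType k :=
  quot (linfun (@vsval k V (lker g)) @^-1: limg f)%VS.

Definition Tor (R : rmodule A) N (n : nat) : vectType k :=
  if n is n'.+1
  then homology (tensA_map R (min_res_diff N n'.+1)) (tensA_map R (min_res_diff N n'))
  else quot (limg (tensA_map R (min_res_diff N 0))).

End Homological.

Definition infinite_graded (k : fieldType) (V : nat -> vectType k) :=
  forall N, exists2 n, (N <= n)%N & exists v : V n, v != 0.

Section EnvelopingAlgebra.
Variables (k : fieldType) (A : falgType k).

(* A (x) A^op *)
Definition env : Type := tens A A.
HB.instance Definition _ := Vector.copy env (tens A A).

Definition epure (a b : A) : env := tpure a b.
Definition emul (s t : env) : env :=
  tlift (fun a b => tlift (fun c d => epure (a * c) (d * b)) t) s.
Definition eone : env := epure 1 1.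

Lemma env_eq_lin (W : lmodType k) (f g : env -> W) :
  linear f -> linear g -> (forall a b, f (epure a b) = g (epure a b)) -> f =1 g.
Proof. exact: tens_eq_lin. Qed.

Lemma epure_linl b : linear (epure^~ b).
Proof. by have [bl _] := @tpure_bilin k A A; apply: bl. Qed.
Lemma epure_linr a : linear (epure a).
Proof. by have [_ br] := @tpure_bilin k A A; apply: br. Qed.

Lemma emul_bilin_in a b : bilin (fun c d : A => epure (a * c) (d * b)).
Proof.
split=> [d|c] x u v.
  by rewrite mulrDr -scalerAr epure_linl.
by rewrite mulrDl -scalerAl epure_linr.
Qed.

Lemma emul_linl t : linear (emul^~ t).
Proof. by move=> c x y; rewrite /emul linearP. Qed.

Lemma emul_bilin_out t :
  bilin (fun a b => tlift (fun c d => epure (a * c) (d * b)) t : env).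
Proof.
split=> [b|a] c x y; rewrite /tlift scaler_sumr -big_split; apply: eq_bigr => i _ /=;
  rewrite scaler_sumr -big_split; apply: eq_bigr => j _ /=;
  rewrite scalerA mulrC -scalerA -scalerDr; congr (_ *: _).
  by rewrite mulrDl -scalerAl epure_linl.
by rewrite mulrDr -scalerAr epure_linr.
Qed.

Lemma emul_linr s : linear (emul s).
Proof.
move=> c x y.
apply: (env_eq_lin (f := fun s => emul s (c *: x + y))
   (g := fun s => c *: emul s x + emul s y)).
- exact: emul_linl.
- exact: lin_comb (emul_linl x) (emul_linl y).
move=> a b; rewrite /emul !tlift_pure; try exact: emul_bilin_out.
exact: tlift_is_linear.
Qed.

Lemma emul_pure a b c d : emul (epure a b) (epure c d) = epure (a * c) (d * b).
Proof.
rewrite /emul tlift_pure; last exact: emul_bilin_out.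
by rewrite tlift_pure //; apply: emul_bilin_in.
Qed.

Lemma emulA : associative emul.
Proof.
move=> u v w.
apply: (env_eq_lin (f := fun u => emul u (emul v w))
                   (g := fun u => emul (emul u v) w)).
- exact: emul_linl.
- exact: (lin_comp (emul_linl w) (emul_linl v)).
move=> a b.
apply: (env_eq_lin (f := fun v => emul (epure a b) (emul v w))
                   (g := fun v => emul (emul (epure a b) v) w)).
- exact: (lin_comp (emul_linr _) (emul_linl w)).
- exact: (lin_comp (emul_linl w) (emul_linr _)).
move=> c d.
apply: (env_eq_lin (f := fun w => emul (epure a b) (emul (epure c d) w))
                   (g := fun w => emul (emul (epure a b) (epure c d)) w)).
- exact: (lin_comp (emul_linr _) (emul_linr _)).
- exact: emul_linr.
by move=> e f; rewrite !emul_pure !mulrA.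
Qed.

Lemma emul1l : left_id eone emul.
Proof.
apply: env_eq_lin (emul_linr _) _ _ => // a b.
by rewrite emul_pure mul1r mulr1.
Qed.
Lemma emul1r : right_id eone emul.
Proof.
apply: env_eq_lin (emul_linl _) _ _ => // a b.
by rewrite emul_pure mul1r mulr1.
Qed.
Lemma emulDl : left_distributive emul +%R.
Proof. by move=> u v w; have := emul_linl w 1 u v; rewrite !scale1r. Qed.
Lemma emulDr : right_distributive emul +%R.
Proof. by move=> u v w; have := emul_linr u 1 v w; rewrite !scale1r. Qed.
Lemma eone_neq0 : eone != 0.
Proof.
apply/eqP => /matrixP e0; have /eqP[] := oner_neq0 A.
rewrite (coord_vbasis (memvf 1)) big1 // => i _.
move: (e0 i i); rewrite !mxE => /eqP; rewrite mulf_eq0 orbb => /eqP ->.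
exact: scale0r.
Qed.

HB.instance Definition _ := GRing.Zmodule_isNzRing.Build env
  emulA emul1l emul1r emulDl emulDr eone_neq0.

Lemma env_scalerAl (c : k) (s t : env) : c *: (s * t) = c *: s * t.
Proof.
have := emul_linl t c s 0; rewrite !addr0 => e; rewrite -[RHS]/(emul _ _) e.
have /eqP := emul_linl t 1 0 0; rewrite !scale1r addr0 -subr_eq subrr => /eqP <-.
by rewrite addr0.
Qed.
Lemma env_scalerAr (c : k) (s t : env) : c *: (s * t) = s * (c *: t).
Proof.
have := emul_linr s c t 0; rewrite !addr0 => e; rewrite -[RHS]/(emul _ _) e.
have /eqP := emul_linr s 1 0 0; rewrite !scale1r addr0 -subr_eq subrr => /eqP <-.
by rewrite addr0.
Qed.

HB.instance Definition _ := GRing.Lmodule_isLalgebra.Build k env env_scalerAl.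
HB.instance Definition _ := GRing.Lalgebra_isAlgebra.Build k env env_scalerAr.
HB.instance Definition _ := Algebra_isFalgebra.Build k env.

Lemma epureM a b c d : epure a b * epure c d = epure (a * c) (d * b).
Proof. exact: emul_pure. Qed.

(* The anti-automorphism a (x) b |-> b (x) a. *)
Definition eswap (t : env) : env := tlift (fun a b => epure b a) t.

Lemma eswap_linear : linear eswap.
Proof. exact: tlift_is_linear. Qed.
Lemma eswap_pure a b : eswap (epure a b) = epure b a.
Proof.
rewrite /eswap tlift_pure //; split=> [y|x]; [exact: epure_linr | exact: epure_linl].
Qed.
Lemma eswapM s t : eswap (s * t) = eswap t * eswap s.
Proof.
apply: (env_eq_lin (f := fun s => eswap (s * t)) (g := fun s => eswap t * eswap s)).
- exact: (lin_comp eswap_linear (emul_linl t)).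
- exact: (lin_comp (emul_linr _) eswap_linear).
move=> a b.
apply: (env_eq_lin (f := fun t => eswap (epure a b * t))
                   (g := fun t => eswap t * eswap (epure a b))).
- exact: (lin_comp eswap_linear (emul_linr _)).
- exact: (lin_comp (emul_linl _) eswap_linear).
by move=> c d; rewrite !(epureM, eswap_pure).
Qed.

End EnvelopingAlgebra.

Section Bimodules.
Variables (k : fieldType) (A : falgType k).

Definition bimodule := lmodule (env A).

Definition breg_act (t : env A) : 'End(A) :=
  linfun (fun x => tlift (fun a b => a * x * b) t).

Lemma breg_bilin x : bilin (fun a b : A => a * x * b).
Proof.
split=> [b|a] c u v; first by rewrite !mulrDl -!scalerAl.
by rewrite mulrDr -scalerAr.
Qed.

Lemma breg_linear_in (t : env A) : linear (fun x => tlift (fun a b => a * x * b) t).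
Proof.
move=> c x y.
apply: (env_eq_lin (f := fun t => tlift (fun a b => a * (c *: x + y) * b) t)
  (g := fun t => c *: tlift (fun a b => a * x * b) t + tlift (fun a b => a * y * b) t)).
- exact: tlift_is_linear.
- by apply: lin_comb; apply: tlift_is_linear.
move=> a b; rewrite !tlift_pure; try exact: breg_bilin.
by rewrite mulrDr -scalerAr mulrDl -scalerAl.
Qed.

Lemma breg_actE a b x : breg_act (epure a b) x = a * x * b.
Proof.
rewrite /breg_act linfunE; last exact: breg_linear_in.
by rewrite tlift_pure //; apply: breg_bilin.
Qed.

Lemma breg_act_linear : linear breg_act.
Proof.
move=> c s t; apply/lfunP => x; rewrite add_lfunE scale_lfunE.
by rewrite /breg_act !linfunE; try exact: breg_linear_in; apply: tlift_is_linear.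
Qed.
Lemma breg_act1 : breg_act 1 = \1%VF.
Proof. by apply/lfunP => x; rewrite breg_actE mul1r mulr1 id_lfunE. Qed.
Lemma breg_actM s t : breg_act (s * t) = (breg_act s \o breg_act t)%VF.
Proof.
apply: (env_eq_lin (f := fun s => breg_act (s * t))
                   (g := fun s => breg_act s \o breg_act t)%VF).
- exact: (lin_comp breg_act_linear (emul_linl t)).
- by move=> c u v; rewrite breg_act_linear comp_lfunDl comp_lfunZl.
move=> a b.
apply: (env_eq_lin (f := fun t => breg_act (epure a b * t))
                   (g := fun t => breg_act (epure a b) \o breg_act t)%VF).
- exact: (lin_comp breg_act_linear (emul_linr _)).
- by move=> c u v; rewrite breg_act_linear comp_lfunDr comp_lfunZr.
move=> c d; apply/lfunP => x.
by rewrite epureM comp_lfunE !breg_actE !mulrA.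
Qed.

(* A as a bimodule over itself: (a (x) b) x = a x b. *)
Definition bregular : bimodule := LModule breg_act_linear breg_act1 breg_actM.

Section Dual.
Variable X : bimodule.

Definition bdual_act (t : env A) : 'End(dualsp X) :=
  linfun (fun f : dualsp X => (f \o lact X (eswap t))%VF : dualsp X).

Lemma bdual_actE t f x :
  (bdual_act t f : 'Hom(X, k^o)) x = (f : 'Hom(X, k^o)) (lact X (eswap t) x).
Proof.
rewrite /bdual_act linfunE ?comp_lfunE // => c g h.
by apply/lfunP => m; rewrite !lfun_simp.
Qed.

Lemma bdual_linear : linear bdual_act.
Proof.
move=> c s t; apply/lfunP => f; apply/lfunP => x.
by rewrite bdual_actE eswap_linear lactPE !lfun_simp !bdual_actE linearP.
Qed.
Lemma bdual_act1 : bdual_act 1 = \1%VF.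
Proof.
apply/lfunP => f; apply/lfunP => x.
by rewrite bdual_actE -[1]/(epure 1 1) eswap_pure lact1E id_lfunE.
Qed.
Lemma bdual_actM s t : bdual_act (s * t) = (bdual_act s \o bdual_act t)%VF.
Proof.
apply/lfunP => f; apply/lfunP => x.
by rewrite comp_lfunE !bdual_actE eswapM lactME.
Qed.

(* D X, with (a f b)(x) = f (b x a). *)
Definition bdual : bimodule := LModule bdual_linear bdual_act1 bdual_actM.
End Dual.

(* Only meaningful for n >= 1. *)
Definition HH_tau_coh (X : bimodule) (n : nat) : vectType k :=
  dualsp (Hom_space X (tau_n n bregular)).
Definition HH_tau_hom (X : bimodule) (n : nat) : vectType k :=
  Hom_space (bdual X) (tau_n n bregular).

End Bimodules.

Section Ideals.
Variables (k : fieldType) (Q : quiver).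
Implicit Types (u v : path_algebra k Q) (I J : path_algebra k Q -> Prop).

Record two_sided_ideal I : Prop := TwoSidedIdeal {
  ideal0 : I 0;
  idealD : forall u v, I u -> I v -> I (u + v);
  idealMl : forall u v, I v -> I (u * v);
  idealMr : forall u v, I u -> I (u * v) }.

(* F, the span of the paths of positive length. *)
Definition arrow_ideal u : Prop :=
  forall p, pa_coef p u != 0 -> (0 < path_length p)%N.

(* J ^ m, for m > 0: the finite sums of products of m elements of J. *)
Definition ideal_pow J (m : nat) u : Prop :=
  exists s : seq (m.-tuple (path_algebra k Q)),
    (forall t, t \in s -> forall v, v \in (t : seq _) -> J v) /\
    u = \sum_(t <- s) \prod_(v <- t) v.

Definition admissible I : Prop :=
  [/\ two_sided_ideal I,
      exists2 m, (2 <= m)%N & forall u, ideal_pow arrow_ideal m u -> I u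
    & forall u, I u -> ideal_pow arrow_ideal 2 u].

Lemma arrow_ideal_pow2_trivial u x :
  ideal_pow arrow_ideal 2 u -> pa_coef (trivial_path x) u = 0.
Proof.
case=> s [Fs ->]; rewrite pa_coef_sum big_seq big1 // => t ts.
case: t / tupleP ts => v t; case: t / tupleP => w t; rewrite tuple0 => ts.
rewrite /= !big_cons big_nil mulr1 pa_coef_trivialM.
have Fv : arrow_ideal v by apply: (Fs _ ts); rewrite !inE eqxx.
by have [->|/Fv] := eqVneq (pa_coef (trivial_path x) v) 0; rewrite ?mul0r.
Qed.

(* kQ / I, as a finite-dimensional algebra with a surjection from kQ of kernel I. *)
Record bound_quiver_algebra I := BoundQuiverAlgebra {
  bqa_alg :> falgType k;
  bqa_proj : {rmorphism path_algebra k Q -> bqa_alg};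
  bqa_projZ : forall c u, bqa_proj (c *: u) = c *: bqa_proj u;
  bqa_surj : forall a, exists u, bqa_proj u = a;
  bqa_ker : forall u, bqa_proj u = 0 <-> I u;
  bqa_admissible : admissible I }.

End Ideals.

Section BoundQuiverAlgebras.
Variables (k : fieldType) (Q : quiver) (I : path_algebra k Q -> Prop).
Variable L : bound_quiver_algebra I.

Definition vertex_idem (x : vertex Q) : L := bqa_proj L (pa_path k (trivial_path x)).

(* The character of the simple modules at x: the coefficient of the trivial path. *)
Definition vertex_char (x : vertex Q) (a : L) : k :=
  pa_coef (trivial_path x) (projT1 (boolp.cid (bqa_surj a))).

Lemma vertex_charE x u : vertex_char x (bqa_proj L u) = pa_coef (trivial_path x) u.
Proof.
rewrite /vertex_char; case: boolp.cid => v /= ev.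
have : bqa_proj L (v - u) = 0 by rewrite rmorphB ev subrr.
have [_ _ I2] := bqa_admissible L.
move/bqa_ker/I2/(arrow_ideal_pow2_trivial x); rewrite pa_coefB => /eqP.
by rewrite subr_eq0 => /eqP.
Qed.

Lemma vertex_char_linear x : linear (vertex_char x : L -> k^o).
Proof.
move=> c a b; have [u <-] := bqa_surj a; have [v <-] := bqa_surj b.
rewrite -bqa_projZ -rmorphD !vertex_charE; exact: pa_coef_is_linear.
Qed.
Lemma vertex_char1 x : vertex_char x 1 = 1.
Proof.
rewrite -(rmorph1 (bqa_proj L)) vertex_charE -[1]/(pa_one k Q) /pa_one pa_coef_sum.
rewrite (bigD1 x) //= pa_coefE eqxx big1 ?addr0 // => y nyx.
rewrite pa_coefE; case: eqP => // /(congr1 (@path_start Q)) e.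
by case/eqP: nyx.
Qed.
Lemma vertex_charM x a b : vertex_char x (a * b) = vertex_char x a * vertex_char x b.
Proof.
have [u <-] := bqa_surj a; have [v <-] := bqa_surj b.
by rewrite -rmorphM !vertex_charE pa_coef_trivialM.
Qed.

Definition simple_act x (a : L) : 'End(k^o : vectType k) :=
  (vertex_char x a *: \1)%VF.

Lemma simple_act_linear x : linear (simple_act x).
Proof. by move=> c a b; rewrite /simple_act vertex_char_linear scalerDl scalerA. Qed.
Lemma simple_act1 x : simple_act x 1 = \1%VF.
Proof. by rewrite /simple_act vertex_char1 scale1r. Qed.
Lemma simple_actM x a b : simple_act x (a * b) = (simple_act x a \o simple_act x b)%VF.
Proof.
by rewrite /simple_act vertex_charM -comp_lfunZl -comp_lfunZr comp_lfun1l scalerA.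
Qed.
Lemma simple_actMr x a b : simple_act x (a * b) = (simple_act x b \o simple_act x a)%VF.
Proof.
by rewrite /simple_act vertex_charM -comp_lfunZl -comp_lfunZr comp_lfun1l scalerA mulrC.
Qed.

Definition left_simple x : lmodule L :=
  LModule (simple_act_linear x) (simple_act1 x) (simple_actM x).
Definition right_simple x : rmodule L :=
  RModule (simple_act_linear x) (simple_act1 x) (simple_actMr x).

(* y L x <> 0 *)
Definition corner_neq0 (y x : vertex Q) : Prop :=
  exists a : L, vertex_idem y * a * vertex_idem x != 0.

Definition infinite_plus_gldim : Prop :=
  exists y x, corner_neq0 y x /\
    infinite_graded (Tor (right_simple x) (left_simple y)).

Definition infinite_coplus_gldim : Prop :=
  exists y x, corner_neq0 y x /\
    infinite_graded (Tor (right_simple y) (left_simple x)).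

End BoundQuiverAlgebras.

(* Main.v *)
Require Import Defs.
From mathcomp Require Import all_boot all_algebra all_field.
From mathcomp Require boolp.

Set Implicit Arguments.
Unset Strict Implicit.
Unset Printing Implicit Defensive.

Import GRing.Theory.
Local Open Scope ring_scope.

(** Write [A] for the algebra, [E] for its enveloping algebra, [c y] for the
    character of the simple modules at the vertex [y], [P n] for the terms of
    the minimal projective resolution of the bimodule [A], and [X] for a
    bimodule. Both equivalences are the same statement, for [X = A] and for
    [X = D A].

    For projective [P], the space [Hom_E(X, D (Hom_E(P, E)))] is dual to
    [Hom_E(P, X)] (dual bases, [projective_dual_basis]). Hence
    [Hom_E(X, tau_{n+1} A)] is dual to the cokernel of the map
    [Hom_E(P n, X) -> Hom_E(P n.+1, X)]. The vanishing of this cokernel in one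
    degree says little, but infinitely many of them are nonzero if and only if
    infinitely many [Hom_E(P n, X)] are nonzero: the composite of two
    consecutive maps is zero, so both are onto only if the last space is zero
    ([hom_tau_neq0_hom], [hom_tau_neq0_consecutive]).

    The simple bimodules are the one-dimensional modules given by the characters
    [a (x) b |-> c y a * c x b], and for projective [P] there is a nonzero
    morphism [P -> X] if and only if some pair [(y, x)] satisfies
    [e_y X e_x <> 0] while [P] maps onto the simple bimodule at [(y, x)]
    ([projective_hom_corner]).

    It remains to see that [P n] maps onto the simple bimodule at [(y, x)] if
    and only if [Tor_n(k_y, _xk) <> 0]. Over [E] and over [A], a module and its
    projective cover have the same simple quotients, and the complex computing
    [Tor(k_y, _)] from a minimal resolution has zero differentials
    ([Tor_neq0]); so the claim compares the simple quotients of the syzygies of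
    [A] over [E] with those of the syzygies of [_xk] over [A]. The functor
    [M |-> M (x)_A _xk] carries the former to the latter ([collapse_syzygy]):
    base change preserves projective covers, it is exact on the
    sequences in question because syzygies of [A] are projective as right
    modules, and it sends [A] to [_xk]. It does not change the simple quotients
    at [(y, x)] by adjunction ([collapse_eigenform]).

    There are finitely many pairs [(y, x)], so if infinitely many degrees are
    nonzero then a single pair accounts for infinitely many of them. Finally
    [e_y (D A) e_x] is dual to [e_x A e_y], which exchanges the two vertices
    in the homological case. *)

(** * Linear forms and dual bases *)

Section LinearForms.
Variable k : fieldType.
Implicit Types V W : vectType k.

Lemma form_neq0 V (v : V) : v != 0 -> exists l : 'Hom(V, k^o), l v != 0.
Proof.
move=> nv.
have [i ci] : exists i, coord (vbasis {:V}) i v != 0.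
  apply/existsP; apply: contraR nv; rewrite negb_exists => /forallP c0.
  rewrite (coord_vbasis (memvf v)) big1 // => i _.
  by move/negPn/eqP: (c0 i) => ->; rewrite scale0r.
exists (linfun (coord (vbasis {:V}) i : V -> k^o)).
by rewrite lfunE.
Qed.

Lemma form_separates V (U : {vspace V}) v : v \notin U ->
  exists2 l : 'Hom(V, k^o), forall u, u \in U -> l u = 0 & l v != 0.
Proof.
rewrite -{1}[U]lker_qproj memv_ker.
case/(@form_neq0 (quot U)) => l lv.
exists (l \o qproj U)%VF; last by rewrite comp_lfunE.
by move=> u; rewrite -{1}[U]lker_qproj memv_ker comp_lfunE => /eqP->; rewrite linear0.
Qed.

Lemma lfun_neq0 V W (f : 'Hom(V, W)) : f != 0 -> exists v, f v != 0.
Proof.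
move=> nf; apply: boolp.contrapT => no.
case/eqP: nf; apply/lfunP => v; rewrite zero_lfunE; apply/eqP/negPn/negP => fv.
by apply: no; exists v.
Qed.

End LinearForms.

Section Actions.
Variables (k : fieldType) (A : falgType k).
Implicit Types M N P X : lmodule A.

Lemma lactD M a b m : lact M (a + b) m = lact M a m + lact M b m.
Proof. by have := lactPE 1 a b m; rewrite !scale1r. Qed.
Lemma lact0 M m : lact M 0 m = 0.
Proof. by apply: (addrI (lact M 0 m)); rewrite -lactD !addr0. Qed.
Lemma lactZ M c a m : lact M (c *: a) m = c *: lact M a m.
Proof. by rewrite -[_ *: a]addr0 lactPE lact0 addr0. Qed.

(** The coordinate forms come from a section of the surjection onto [P] from the
    free module on a vector space basis of [P]. *)
Lemma projective_dual_basis P : projective P ->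
  exists f : 'I_(\dim {:P}) -> 'Hom(P, lregular A),
    (forall j, lhom (f j)) /\
    forall p, p = \sum_j lact P (f j p : A) (vbasis {:P})`_j.
Proof.
move=> pP.
have il : linear (@idfun P) by [].
pose b a (v : P) : P := lact P a v.
have bb : bilin b by apply: lact_bilin il.
pose g : 'Hom(free_module A P, P) := linfun (tlift b).
have hg : lhom g by exact: (free_ext_hom il).
have gE a v : g (tpure a v) = lact P a v.
  by rewrite /g lfunE /= tlift_pure.
have sg : limg g = fullv.
  apply/vspaceP => m; rewrite memvf; apply/memv_imgP; exists (tpure 1 m).
    exact: memvf.
  by rewrite gE lact1E.
have [s hs es] : exists2 h : 'Hom(P, free_module A P), lhom h & \1%VF = (g \o h)%VF.
  by apply: pP => // a m; rewrite !id_lfunE.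
pose c j a (v : P) : lregular A := coord (vbasis {:P}) j v *: (a : A).
have cb j : bilin (c j).
  split=> [v|a] d x y; rewrite /c.
    by rewrite scalerDr !scalerA mulrC.
  by rewrite linearP scalerDl scalerA.
pose F j : 'Hom(free_module A P, lregular A) := linfun (tlift (c j)).
have FE j a v : F j (tpure a v) = coord (vbasis {:P}) j v *: (a : A).
  by rewrite /F lfunE /= tlift_pure.
have hF j : lhom (F j).
  move=> a m.
  have : (F j \o free_act P a = lact (lregular A) a \o F j)%VF.
    apply: lfun_tens_eq => x v; rewrite !comp_lfunE free_actE !FE /=.
    by rewrite linearZ /= lfunE.
  by move/lfunP/(_ m); rewrite !comp_lfunE.
exists (fun j => F j \o s)%VF; split=> [j|p]; first exact: lhom_comp.
have key : g =1 (fun t => \sum_j lact P (F j t : A) (vbasis {:P})`_j).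
  apply: tens_eq_lin => [|d x y|a v].
  - exact: linearP.
  - rewrite scaler_sumr -big_split; apply: eq_bigr => j _ /=.
    by rewrite linearP lactPE.
  rewrite gE {1}(coord_vbasis (memvf v)) linear_sum.
  by apply: eq_bigr => j _; rewrite FE lactZ linearZ.
by rewrite -{1}[p]id_lfunE es comp_lfunE key; apply: eq_bigr => j _; rewrite comp_lfunE.
Qed.

End Actions.

(** * Morphisms into the Auslander-Reiten translate *)

Section TauHom.
Variables (k : fieldType) (A : falgType k).
Implicit Types M N P X : lmodule A.

Definition hom_at P X (f : 'Hom(P, lregular A)) (x : X) : 'Hom(P, X) :=
  linfun (fun p => lact X (f p : A) x).

Lemma hom_atE P X (f : 'Hom(P, lregular A)) (x : X) p :
  hom_at f x p = lact X (f p : A) x.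
Proof. by rewrite /hom_at linfunE // => c a b; rewrite linearP lactPE. Qed.

Lemma hom_at_hom P X (f : 'Hom(P, lregular A)) (x : X) : lhom f -> lhom (hom_at f x).
Proof. by move=> hf a p; rewrite !hom_atE hf /= lfunE /= lactME. Qed.

(** With [P1 = pcover (Omega M)], a morphism [Psi] into [tau M = D (Tr M)] is a
    pairing of [X] with [Hom(P1, A)], balanced over [A]. Expanding [phi] in the dual basis [(q_j, f_j)]
    of [P1] as [\sum_j f_j phi(q_j)], balancedness turns the value at [(x, phi)]
    into the sum of the values at [(phi(q_j) x, f_j)]. So a nonzero pairing
    forces one of the morphisms [phi(-) x : P1 -> X] to be nonzero. *)
Lemma hom_tau_neq0_hom M X (Psi : 'Hom(X, tau M)) :
  lhom Psi -> Psi != 0 ->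
  exists2 h : 'Hom(pcover (Omega M), X), lhom h & h != 0.
Proof.
set P := pcover (Omega M) => hPsi /lfun_neq0[x].
have [f [hf pf]] := projective_dual_basis (pc_projective (pcover (Omega M))).
move=> /lfun_neq0[c]; rewrite -[c]qprojK; set phi := qrepr c; clearbody phi.
pose fj j : hom_reg P := vsproj (lhoms P (lregular A)) (f j).
have fjE j p : vsval (fj j) p = f j p by rewrite vsprojK //; apply/lhomsP/hf.
pose q (j : 'I_(\dim {:P})) : P := (vbasis {:P})`_j.
have hphi : lhom (vsval phi : 'Hom(P, lregular A)) by apply/lhomsP/subvsP.
have -> : phi = \sum_j ract (hom_reg P) (vsval phi (q j) : A) (fj j).
  apply: hom_reg_eq => p.
  rewrite (linear_sum (@vsval _ _ _)) sum_lfunE {1}[p]pf linear_sum.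
  apply: eq_bigr => j _.
  by rewrite [RHS](@hom_reg_actE _ _ P) fjE [LHS]hphi /= lfunE.
pose T := limg (hom_reg_map (pres_map M)).
have step a (g : hom_reg P) :
    (Psi x : 'Hom(Tr M, k^o)) (qproj T (ract (hom_reg P) a g)) =
    (Psi (lact X a x) : 'Hom(Tr M, k^o)) (qproj T g).
  rewrite hPsi [RHS](rdual_actE (N := Tr M)); congr (_ _).
  exact/esym/(rquot_actE (hom_reg_map_stable (@pres_map_hom _ _ M))).
move=> nz; have [j nzj] : exists j, lact X (vsval phi (q j) : A) x != 0.
  apply/existsP; apply: contraR nz; rewrite negb_exists => /forallP z.
  rewrite !linear_sum big1 // => j _.
  rewrite [LHS]step.
  by move/negPn/eqP: (z j) => ->; rewrite linear0 zero_lfunE.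
exists (hom_at (vsval phi) x); first exact: hom_at_hom.
by apply: contraNneq nzj => /lfunP/(_ (q j)); rewrite hom_atE zero_lfunE => ->.
Qed.

(** A linear form [l] that vanishes on the morphisms factoring through the
    presentation, but not on [h], gives the pairing [(x, phi) |-> l (phi(-) x)],
    which descends to [Tr M]. It is not zero because [h] is the sum of the
    [f_j(-) h(q_j)]. *)
Lemma hom_tau_of_nonfactoring M X (h : 'Hom(pcover (Omega M), X)) :
  lhom h ->
  (forall g : 'Hom(pcover M, X), lhom g -> h <> (g \o pres_map M)%VF) ->
  exists2 Psi : 'Hom(X, tau M), lhom Psi & Psi != 0.
Proof.
set P := pcover (Omega M) => hh nofac; pose d := pres_map M.
have hd : lhom d := @pres_map_hom _ _ M.
have [f [hf pf]] := projective_dual_basis (pc_projective (pcover (Omega M))).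
pose pre (g : 'Hom(pcover M, X)) : 'Hom(P, X) := (g \o d)%VF.
have prel : linear pre by move=> c g g'; rewrite /pre comp_lfunDl comp_lfunZl.
pose U : {vspace 'Hom(P, X)} := (linfun pre @: lhoms (pcover M) X)%VS.
have nhU : h \notin U.
  apply/negP => /memv_imgP[g /lhomsP hg e]; apply: (nofac g hg).
  by rewrite e linfunE.
have [l lU lh] := form_separates nhU.
pose T := limg (hom_reg_map d).
(* This makes the pairing well defined on [Tr M], a quotient by [T]. *)
have lT (phi : hom_reg P) x : phi \in T -> l (hom_at (vsval phi) x) = 0.
  case/memv_imgP => g _ ->; apply: lU; apply/memv_imgP.
  have hg : lhom (vsval g : 'Hom(pcover M, lregular A)) by apply/lhomsP/subvsP.
  exists (hom_at (vsval g) x); first exact/lhomsP/hom_at_hom.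
  rewrite [RHS]linfunE //; apply/lfunP => p.
  by rewrite [LHS]hom_atE [RHS]comp_lfunE [RHS]hom_atE hom_reg_mapE.
have ev_l x : linear (fun phi : hom_reg P => l (hom_at (vsval phi) x) : k^o).
  move=> c a b; rewrite -linearP; congr (l _); apply/lfunP => p.
  by rewrite add_lfunE scale_lfunE !hom_atE linearP /= add_lfunE scale_lfunE lactPE.
have ev_r (phi : hom_reg P) : linear (fun x : X => l (hom_at (vsval phi) x) : k^o).
  move=> c a b; rewrite -linearP; congr (l _); apply/lfunP => p.
  by rewrite add_lfunE scale_lfunE !hom_atE linearP.
have evT (phi psi : hom_reg P) x : phi - psi \in T ->
    l (hom_at (vsval phi) x) = l (hom_at (vsval psi) x).
  rewrite addrC -scaleN1r => /(lT _ x); rewrite ev_l scaleN1r => /eqP.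
  by rewrite addrC subr_eq0 => /eqP.
pose PsiF x : tau M := linfun (fun c : Tr M => l (hom_at (vsval (qrepr c)) x) : k^o).
have PsiFE x (phi : hom_reg P) :
    (PsiF x : 'Hom(Tr M, k^o)) (qproj T phi) = l (hom_at (vsval phi) x).
  rewrite /PsiF linfunE; first by apply: evT; rewrite -opprB memvN; apply: qreprK.
  by move=> c a b; rewrite -ev_l /qrepr linearP.
have PsiFl : linear PsiF.
  move=> c x y; apply/lfunP => w; rewrite -[w]qprojK.
  by rewrite add_lfunE scale_lfunE !PsiFE ev_r.
pose Psi : 'Hom(X, tau M) := linfun PsiF.
have PsiE x : Psi x = PsiF x by rewrite /Psi linfunE.
exists Psi.
  move=> a x; rewrite !PsiE; apply/lfunP => w; rewrite -[w]qprojK.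
  rewrite PsiFE [RHS](rdual_actE (N := Tr M)) /=.
  rewrite (rquot_actE (hom_reg_map_stable (@pres_map_hom _ _ M))) PsiFE.
  congr (l _); apply/lfunP => p.
  by rewrite !hom_atE [X in _ = lact _ X _](@hom_reg_actE _ _ P) lactME.
pose fj j : hom_reg P := vsproj (lhoms P (lregular A)) (f j).
have fjE j p : vsval (fj j) p = f j p by rewrite vsprojK //; apply/lhomsP/hf.
apply: contraNneq lh => Psi0.
have -> : h = \sum_j hom_at (vsval (fj j)) (h (vbasis {:P})`_j).
  apply/lfunP => p; rewrite sum_lfunE {1}[p]pf linear_sum.
  by apply: eq_bigr => j _; rewrite [RHS]hom_atE fjE [LHS]hh.
rewrite linear_sum big1 // => j _.
apply: (etrans (esym (PsiFE _ (fj j)))).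
by rewrite -PsiE Psi0 zero_lfunE zero_lfunE.
Qed.

Lemma pres_mapK M : (pres_map M \o pres_map (Omega M) = 0)%VF.
Proof.
apply/lfunP => p; rewrite zero_lfunE comp_lfunE.
set w := pres_map (Omega M) p; rewrite /pres_map comp_lfunE.
suff -> : pc_map (pcover (Omega M)) w = 0 by rewrite linear0.
apply/eqP; rewrite -memv_ker /w /pres_map comp_lfunE sub_inclE; exact: subvsP.
Qed.

(** If every morphism out of each of two consecutive terms factored through the
    differential, then every morphism out of the second would factor through the
    composite of two differentials, hence vanish. *)
Lemma hom_tau_neq0_consecutive M X (h : 'Hom(pcover (Omega (Omega M)), X)) :
  lhom h -> h != 0 ->
  (exists2 Psi : 'Hom(X, tau M), lhom Psi & Psi != 0) \/
  (exists2 Psi : 'Hom(X, tau (Omega M)), lhom Psi & Psi != 0).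
Proof.
move=> hh nh.
have [fac|nofac] := boolp.EM (exists2 g : 'Hom(pcover (Omega M), X), lhom g &
    h = (g \o pres_map (Omega M))%VF); last first.
  by right; apply: hom_tau_of_nonfactoring hh _ => g hg e; apply: nofac; exists g.
case: fac => g hg eg; left; apply: hom_tau_of_nonfactoring hg _ => g' hg' eg'.
by case/eqP: nh; rewrite eg eg' -comp_lfunA pres_mapK comp_lfun0r.
Qed.
End TauHom.

(** * Characters and one-dimensional quotients *)

Section Factoring.
Variables (k : fieldType) (U V W : vectType k).

Lemma factor_surj (p : 'Hom(U, V)) (f : 'Hom(U, W)) :
  limg p = fullv -> (lker p <= lker f)%VS ->
  forall u, f ((p^-1)%VF (p u)) = f u.
Proof.
move=> sp /subvP kpf u; apply/eqP; rewrite -subr_eq0 -linearB -memv_ker kpf //.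
by rewrite memv_ker linearB /= limg_lfunVK ?sp ?memvf // subrr.
Qed.

Lemma surj_preim (p : 'Hom(U, V)) : limg p = fullv -> forall v, exists u, p u = v.
Proof. by move=> sp v; exists ((p^-1)%VF v); rewrite limg_lfunVK ?sp ?memvf. Qed.

Lemma surj_limg (p : 'Hom(U, V)) : (forall v, exists u, p u = v) -> limg p = fullv.
Proof.
move=> sp; apply/vspaceP => v; rewrite memvf; apply/memv_imgP.
by have [u <-] := sp v; exists u; rewrite ?memvf.
Qed.

End Factoring.

Section Eigenforms.
Variables (k : fieldType) (B : falgType k).
Implicit Types (chi : B -> k) (M P : lmodule B).

Record character chi : Prop := Character {
  char_linear : linear (chi : B -> k^o);
  char1 : chi 1 = 1;
  charM : forall a b, chi (a * b) = chi a * chi b }.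

(** A nonzero eigenform is a surjection onto the one-dimensional module given by
    [chi]. Working with linear forms keeps the same notion available for modules,
    bimodules and the dual of a tensor product with a simple right module. *)
Definition eigenform chi M (g : 'Hom(M, k^o)) :=
  forall b m, g (lact M b m) = chi b * g m.

Definition has_eigenform chi M :=
  exists2 g : 'Hom(M, k^o), eigenform chi g & g != 0.

(** The kernel of an eigenform [g] is a submodule of codimension at most 1; if [w]
    were outside, the kernel and [U] would span, and superfluousness would give
    [g = 0]. *)
Lemma eigenform_superfluous chi M (g : 'Hom(M, k^o)) (U : {vspace M}) w :
  eigenform chi g -> superfluous U -> w \in U -> g w = 0.
Proof.
move=> hg sU Uw; apply/eqP; apply: contraT => gw.
suff kf : lker g = fullv.
  by have := memvf w; rewrite -kf memv_ker (negbTE gw).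
apply: sU => [b m|]; first by rewrite !memv_ker hg => /eqP->; rewrite mulr0.
apply/vspaceP => v; rewrite memvf; apply/memv_addP.
exists (v - ((g v : k) / g w) *: w).
  by rewrite memv_ker linearB linearZ /= -[_ *: _]/(_ * _) divfK ?subrr.
by exists (((g v : k) / g w) *: w); rewrite ?memvZ // subrK.
Qed.

Lemma has_eigenform_pcover chi M : has_eigenform chi (pcover M) <-> has_eigenform chi M.
Proof.
set p := pc_map (pcover M).
have sp : limg p = fullv := pc_surj (pcover M).
have hp : lhom p := pc_hom (pcover M).
split=> [[g hg ng]|[g hg /lfun_neq0[m gm]]].
  have kg : (lker p <= lker g)%VS.
    apply/subvP => w wp; rewrite memv_ker.
    by rewrite (eigenform_superfluous hg (pc_superfluous (pcover M))).
  have gE := factor_surj sp kg.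
  exists (g \o p^-1)%VF.
    move=> b m; have [u <-] := surj_preim sp m.
    by rewrite -hp !comp_lfunE !gE hg.
  have [u gu] := lfun_neq0 ng.
  by apply: contraNneq gu => /lfunP/(_ (p u)); rewrite comp_lfunE gE zero_lfunE => ->.
exists (g \o p)%VF; first by move=> b u; rewrite !comp_lfunE hp hg.
have [u eu] := surj_preim sp m.
by apply: contraNneq gm => /lfunP/(_ u); rewrite comp_lfunE eu zero_lfunE => ->.
Qed.

Section CharModule.
Variables (chi : B -> k) (hchi : character chi).

Definition char_act (b : B) : 'End(k^o : vectType k) := (chi b *: \1)%VF.
Lemma char_act_linear : linear char_act.
Proof. by move=> c a b; rewrite /char_act (char_linear hchi) scalerDl scalerA. Qed.
Lemma char_act1 : char_act 1 = \1%VF.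
Proof. by rewrite /char_act char1 // scale1r. Qed.
Lemma char_actM a b : char_act (a * b) = (char_act a \o char_act b)%VF.
Proof.
by rewrite /char_act charM // -comp_lfunZl -comp_lfunZr comp_lfun1l scalerA.
Qed.
Definition char_module : lmodule B := LModule char_act_linear char_act1 char_actM.

Lemma eigenform_lhom M (g : 'Hom(M, k^o)) :
  eigenform chi g <-> lhom (g : 'Hom(M, char_module)).
Proof.
by split=> hg b m; rewrite hg /= /char_act scale_lfunE id_lfunE.
Qed.

Lemma has_eigenform_lift P M : projective P -> has_eigenform chi P -> has_eigenform chi M ->
  exists2 h : 'Hom(P, M), lhom h & h != 0.
Proof.
move=> pP [f /eigenform_lhom hf nf] [g /eigenform_lhom hg /lfun_neq0[m gm]].
have sg : limg g = fullv.
  apply: surj_limg => v; exists ((v : k) / (g m : k) *: m).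
  by rewrite linearZ /= -[_ *: _]/(_ * _) divfK.
have [h hh e] := pP _ _ _ _ hg sg hf; exists h => //.
by apply: contraNneq nf => h0; rewrite e h0 comp_lfun0r.
Qed.
End CharModule.

End Eigenforms.

(** * Elementary algebras *)

Section ElementaryAlgebra.
Variables (k : fieldType) (A : falgType k) (I : finType).

(** [A] modulo the common kernel of the characters [c i] is a product of copies
    of [k], the idempotents [e i] lift the standard ones, and the common kernel
    is nilpotent. *)
Record elementary (c : I -> A -> k) (e : I -> A) : Prop := Elementary {
  elem_char : forall i, character (c i);
  elem_dual : forall i j, c i (e j) = (i == j)%:R;
  elem_sum : \sum_i e i = 1;
  elem_idem : forall i, e i * e i = e i;
  elem_nilp : exists m, forall s : seq A, size s = m ->
    (forall a, a \in s -> forall i, c i a = 0) -> \prod_(a <- s) a = 0 }.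

Variables (c : I -> A -> k) (e : I -> A).
Hypothesis elA : elementary c e.

(** A nonzero module over an elementary algebra contains a simultaneous
    eigenvector: apply elements of the radical as long as the result is nonzero.
    When the radical [J] kills [u], the element [a * e i] acts on [u] like
    [c i a *: e i], as the two differ by an element of [J]. The action may be on
    either side, and [U] is any set stable under it: this lets the lemma be used
    for the second of two commuting actions, inside the eigenvectors of the
    first. *)
Lemma elementary_socle (V : vectType k) (rho : A -> V -> V) (U : V -> Prop) v :
  (forall v, linear (rho^~ v)) -> (forall v, rho 1 v = v) ->
  (forall a b v, rho a (rho b v) = rho (a * b) v) \/
  (forall a b v, rho a (rho b v) = rho (b * a) v) ->
  (forall a v, U v -> U (rho a v)) -> U v -> v != 0 ->
  exists i, exists u, [/\ U u, u != 0 & forall a, rho a u = c i a *: u].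
Proof.
move=> rl r1 rM rU.
have rD a b u : rho (a + b) u = rho a u + rho b u.
  by rewrite -[a in LHS]scale1r rl scale1r.
have r0 u : rho 0 u = 0 by apply: (addrI (rho 0 u)); rewrite -rD !addr0.
have rZ d a u : rho (d *: a) u = d *: rho a u by rewrite -[d *: a]addr0 rl r0 addr0.
have rB a b u : rho (a - b) u = rho a u - rho b u.
  by rewrite rD -scaleN1r rZ scaleN1r.
pose J a := forall i, c i a = 0.
have [m nilA] := elem_nilp elA.
have cl i := elem_char elA i.
have c0 i : c i 0 = 0.
  by have := char_linear (cl i) (-1) 0 0; rewrite !scaleN1r oppr0 addr0 addNr.
have cZD i d a b : c i (d *: a + b) = d * c i a + c i b.
  exact: (char_linear (cl i)).
have kill s u : size s = m -> (forall a, a \in s -> J a) -> foldr rho u s = 0.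
  case: rM => rM sz js.
    have -> : foldr rho u s = rho (\prod_(a <- s) a) u.
      elim: s {sz js} => [|a s IH] /=; first by rewrite big_nil r1.
      by rewrite IH rM big_cons.
    by rewrite nilA.
  have -> : foldr rho u s = rho (\prod_(a <- rev s) a) u.
    elim: s {sz js} => [|a s IH] /=; first by rewrite big_nil r1.
    by rewrite IH rM rev_cons -cats1 big_cat big_seq1.
  by rewrite nilA ?size_rev // => a; rewrite mem_rev => /js.
suff : forall n u, (forall s, size s = n -> (forall a, a \in s -> J a) -> foldr rho u s = 0) ->
    U u -> u != 0 ->
    exists i, exists u', [/\ U u', u' != 0 & forall a, rho a u' = c i a *: u'].
  by move=> H; apply: (H m) => s; apply: kill.
elim=> [|n IH] u ku Uu nu.
  by case/eqP: nu; apply: (ku [::]).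
have [[j [Jj ju]]|nj] := boolp.EM (exists j, J j /\ rho j u != 0).
  apply: (IH (rho j u)) => [s sz js||//]; last exact: rU.
  rewrite -foldr_rcons; apply: ku; first by rewrite size_rcons sz.
  by move=> a; rewrite mem_rcons inE => /orP[/eqP->|/js].
have Ju j : J j -> rho j u = 0.
  by move=> Jj; apply/eqP; apply/negPn/negP => ju; apply: nj; exists j.
have [i ei] : exists i, rho (e i) u != 0.
  apply/existsP; apply: contraR nu; rewrite negb_exists => /forallP z.
  rewrite -[u]r1 -(elem_sum elA).
  rewrite (big_morph (fun a => rho a u) (fun a b => rD a b u) (r0 u)) big1 // => i _.
  exact/eqP/negPn/z.
exists i, (rho (e i) u); split=> // [|a]; first exact: rU.
have eigen b : (forall j, c j b = c i a * c j (e i)) -> rho b u = c i a *: rho (e i) u.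
  move=> hb; apply/eqP; rewrite -rZ -subr_eq0 -rB; apply/eqP/Ju => j.
  by rewrite addrC -scaleN1r cZD -[_ *: e i]addr0 cZD c0 addr0 hb mulN1r addNr.
have cij j : c j a * c j (e i) = c i a * c j (e i).
  by rewrite (elem_dual elA); case: eqP => [->|_] //; rewrite !mulr0.
by case: rM => rM; rewrite rM eigen // => j; rewrite (charM (cl j)) // mulrC.
Qed.

End ElementaryAlgebra.

(** * Tops of bimodules and morphisms from projective bimodules *)

Section Bimodules.
Variables (k : fieldType) (A : falgType k).
Implicit Types (M P X Y : bimodule A) (chi psi : A -> k).

Lemma lact_epure M a b m :
  lact M (epure a b) m = lact M (epure a 1) (lact M (epure 1 b) m).
Proof. by rewrite -lactME epureM mulr1 mulr1. Qed.

Lemma lact_epureC M a b m :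
  lact M (epure 1 b) (lact M (epure a 1) m) = lact M (epure a 1) (lact M (epure 1 b) m).
Proof. by rewrite -!lactME !epureM !mulr1 !mul1r. Qed.

Section Twist.
Variables (chi : A -> k) (hchi : character chi).

Lemma charZ c a : chi (c *: a) = c * chi a.
Proof.
have c0 : chi 0 = 0.
  by have := char_linear hchi (-1) 0 0; rewrite !scaleN1r oppr0 addr0 addNr.
by have := char_linear hchi c a 0; rewrite c0 !addr0.
Qed.

(** The algebra morphism from the enveloping algebra to [A] whose base change
    functor is the tensor product over [A] with the simple left module given by
    [chi]. *)
Definition twist (t : env A) : A := tlift (fun a b => chi b *: a) t.

Lemma twist_linear : linear twist.
Proof. exact: tlift_is_linear. Qed.

Lemma twist_pure a b : twist (epure a b) = chi b *: a.
Proof.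
rewrite /twist tlift_pure //; split=> [v|u] c x y.
  by rewrite scalerDr !scalerA mulrC.
by rewrite (char_linear hchi) scalerDl -scalerA.
Qed.

Lemma twist_left a : twist (epure a 1) = a.
Proof. by rewrite twist_pure char1 // scale1r. Qed.

Lemma twist1 : twist 1 = 1. Proof. exact: twist_left. Qed.

Lemma twistM s t : twist (s * t) = twist s * twist t.
Proof.
apply: (env_eq_lin (f := fun s => twist (s * t)) (g := fun s => twist s * twist t)).
- exact: (lin_comp twist_linear (emul_linl t)).
- by move=> c x y; rewrite twist_linear mulrDl scalerAl.
move=> a b.
apply: (env_eq_lin (f := fun t => twist (epure a b * t))
                   (g := fun t => twist (epure a b) * twist t)).
- exact: (lin_comp twist_linear (emul_linr _)).
- by move=> c x y; rewrite twist_linear mulrDr scalerAr.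
move=> d f; rewrite epureM !twist_pure charM //.
by rewrite -scalerAl -scalerAr scalerA mulrC.
Qed.

Lemma twist_char psi : character psi -> character (fun t => psi (twist t)).
Proof.
move=> hpsi; split=> [c s t||s t].
- by rewrite twist_linear (char_linear hpsi).
- by rewrite twist1 char1.
by rewrite twistM charM.
Qed.

Section Inflation.
Variable N : lmodule A.
Definition inflate_act (t : env A) : 'End(N) := lact N (twist t).
Lemma inflate_linear : linear inflate_act.
Proof. by move=> c s t; rewrite /inflate_act twist_linear lact_linear. Qed.
Lemma inflate1 : inflate_act 1 = \1%VF.
Proof. by rewrite /inflate_act twist1 lact1. Qed.
Lemma inflateM s t : inflate_act (s * t) = (inflate_act s \o inflate_act t)%VF.
Proof. by rewrite /inflate_act twistM lactM. Qed.
Definition inflate : bimodule A := LModule inflate_linear inflate1 inflateM.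
End Inflation.

End Twist.

Lemma twist_epure psi chi a b : character psi -> character chi ->
  psi (twist chi (epure a b)) = psi a * chi b.
Proof. by move=> hp hc; rewrite twist_pure // charZ // mulrC. Qed.

Lemma eigenform_pure psi chi M (g : 'Hom(M, k^o)) : character psi -> character chi ->
  (forall a b m, g (lact M (epure a b) m) = psi a * chi b * g m) ->
  eigenform (fun t => psi (twist chi t)) g.
Proof.
move=> hpsi hchi hg t m.
apply: (env_eq_lin (W := k^o) (f := fun t => g (lact M t m))
                   (g := fun t => psi (twist chi t) * g m)).
- by move=> c x y; rewrite lactPE linearP.
- move=> c x y; rewrite (char_linear (twist_char hchi hpsi)) mulrDl.
  by congr (_ + _); exact/esym/mulrA.
by move=> a b; rewrite hg twist_epure.
Qed.

Section Top.
Variables (I : finType) (c : I -> A -> k) (e : I -> A).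
Hypothesis elA : elementary c e.

Definition pair_char (i j : I) (t : env A) : k := c i (twist (c j) t).

Lemma pair_charP i j : character (pair_char i j).
Proof. by apply: twist_char; apply: elem_char elA _. Qed.

(** The dual of [M] carries two commuting actions of [A]. Its eigenvectors for
    the first one are stable under the second one, and contain an eigenvector for
    it. *)
Lemma bimodule_top M (m : M) : m != 0 -> exists i j, has_eigenform (pair_char i j) M.
Proof.
case/form_neq0 => l lm.
have nl : l != 0 by apply: contraNneq lm => ->; rewrite zero_lfunE.
pose rho (a : A) (g : 'Hom(M, k^o)) : 'Hom(M, k^o) := (g \o lact M (epure a 1))%VF.
pose rho' (b : A) (g : 'Hom(M, k^o)) : 'Hom(M, k^o) := (g \o lact M (epure 1 b))%VF.
have [|||||i [g [_ ng hg]]] := elementary_socle elA (rho := rho) (U := fun _ => True) _ _ _ _ _ nl.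
- move=> g d a b; apply/lfunP => x; rewrite add_lfunE scale_lfunE !comp_lfunE.
  by rewrite (epure_linl 1 d a b) lactPE linearP.
- by move=> g; apply/lfunP => x; rewrite comp_lfunE lact1E.
- by right=> a b g; apply/lfunP => x; rewrite !comp_lfunE -lactME epureM mulr1.
- by [].
- by [].
have [||||j [f [fi nf hf]]] := elementary_socle elA (rho := rho')
  (U := fun g => forall a, rho a g = c i a *: g) _ _ _ _ hg ng.
- move=> f d a b; apply/lfunP => x; rewrite add_lfunE scale_lfunE !comp_lfunE.
  by rewrite (epure_linr 1 d a b) lactPE linearP.
- by move=> f; apply/lfunP => x; rewrite comp_lfunE lact1E.
- by left=> a b f; apply/lfunP => x; rewrite !comp_lfunE -lactME epureM mulr1.
- move=> b f hf a; apply/lfunP => x; rewrite scale_lfunE !comp_lfunE lact_epureC.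
  by have /lfunP/(_ (lact M (epure 1 b) x)) := hf a; rewrite comp_lfunE scale_lfunE.
exists i, j, f => //; apply: eigenform_pure; [exact: elem_char elA _ .. |].
move=> a b x; rewrite lact_epure.
have /lfunP/(_ (lact M (epure 1 b) x)) := fi a; rewrite comp_lfunE scale_lfunE => ->.
have /lfunP/(_ x) := hf b; rewrite comp_lfunE scale_lfunE => ->.
by rewrite -!mulrA.
Qed.

Lemma pair_char_idem i j : pair_char i j (epure (e i) (e j)) = 1.
Proof.
by rewrite /pair_char twist_epure ?(elem_dual elA) ?eqxx ?mulr1 //; apply: elem_char elA _.
Qed.

(** The idempotent acts nontrivially on [U]. If it still does on the
    kernel [K] of some simple quotient of [U], recurse into [K]; otherwise it acts
    nontrivially on that quotient, which must be the one at [(i, j)]. *)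
Lemma corner_subquotient X (U : {vspace X}) i j (x : X) :
  lstable U -> x \in U -> lact X (epure (e i) (e j)) x != 0 ->
  exists (V : {vspace X}) (stV : lstable V), has_eigenform (pair_char i j) (submodule stV).
Proof.
have [n] := ubnP (\dim U); elim: n U x => // n IH U x ltUn stU Ux nx.
have ex : lact X (epure (e i) (e j)) x \in U by apply: stU.
pose u : submodule stU := vsproj U (lact X (epure (e i) (e j)) x).
have uE : vsval u = lact X (epure (e i) (e j)) x by rewrite vsprojK.
have nu : u != 0 by apply: contraNneq nx => u0; rewrite -uE u0.
have [i' [j' [g hg ng]]] := bimodule_top nu.
pose K : {vspace X} := (sub_incl stU @: lker g)%VS.
have stK : lstable K.
  move=> a y /memv_imgP[w]; rewrite memv_ker => /eqP gw ->.
  rewrite -(sub_incl_hom stU); apply: memv_img.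
  by rewrite memv_ker hg gw mulr0.
have ltK : (\dim K < n)%N.
  rewrite ltnS in ltUn; apply: leq_trans ltUn.
  have [w gw] := lfun_neq0 ng.
  have ltkg : (\dim (lker g) < \dim {: submodule stU})%N.
    rewrite (ltn_leqif (dimv_leqif_eq (subvf _))).
    by apply: contraNneq gw => kf; rewrite -memv_ker kf memvf.
  apply: (@leq_ltn_trans (\dim (lker g))).
    by rewrite -(limg_ker_dim (sub_incl stU) (lker g)) leq_addl.
  by rewrite dimvf in ltkg.
have [gu|gu] := eqVneq (g u) 0.
  apply: (IH K (vsval u)) => //.
    by rewrite -(sub_inclE u) memv_img // memv_ker gu.
  by rewrite uE -lactME epureM !(elem_idem elA).
suff /andP[/eqP ei /eqP ej] : (i' == i) && (j' == j).
  by exists U, stU; rewrite -ei -ej; exists g.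
have eu : lact (submodule stU) (epure (e i) (e j)) u = u.
  apply: subvs_inj; apply: (etrans (sub_actE stU _ u)).
  by rewrite uE -lactME epureM !(elem_idem elA).
have := hg (epure (e i) (e j)) u; rewrite eu => h.
apply: contraNT gu => nij; rewrite h /pair_char twist_epure; try exact: elem_char elA _.
rewrite !(elem_dual elA); move: nij; rewrite negb_and.
by case/orP => /negbTE ->; rewrite ?mulr0 ?mul0r.
Qed.

(** From left to right, take a simple quotient of the image of [h]. From right to
    left, lift the surjection from [P] onto the simple bimodule at [(i, j)] along
    a submodule of [X] that has the same quotient. *)
Lemma projective_hom_corner P X : projective P ->
  (exists2 h : 'Hom(P, X), lhom h & h != 0) <->
  exists i j, (exists x, lact X (epure (e i) (e j)) x != 0) /\
              has_eigenform (pair_char i j) P.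
Proof.
move=> pP; split=> [[h hh /lfun_neq0[p hp]]|[i [j [[x nx] eP]]]].
  have stW : lstable (limg h) := img_stable hh.
  have Wp q : h q \in limg h by rewrite memv_img ?memvf.
  pose r : 'Hom(P, submodule stW) := (linfun (vsproj (limg h)) \o h)%VF.
  have rE q : vsval (r q) = h q by rewrite /r comp_lfunE lfunE /= vsprojK.
  have hr : lhom r by move=> a q; apply: subvs_inj; rewrite rE hh -rE; exact/esym/(sub_actE stW).
  clearbody r; have nr : r p != 0 by apply: contraNneq hp => r0; rewrite -rE r0.
  have [i [j [g hg /lfun_neq0[w gw]]]] := bimodule_top nr.
  have /memv_imgP[q _ eq] := subvsP w.
  have wq : w = r q by apply: subvs_inj; rewrite rE.
  exists i, j; split.
    exists (vsval w); apply: contraNneq gw => z.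
    rewrite -[g w]mul1r -(pair_char_idem i j) -hg.
    suff -> : lact (submodule stW) (epure (e i) (e j)) w = 0 by rewrite linear0.
    by apply: subvs_inj; apply: (etrans (sub_actE stW _ w)); rewrite z linear0.
  exists (g \o r)%VF; first by move=> t m; rewrite !comp_lfunE hr hg.
  by apply: contraNneq gw => /lfunP/(_ q); rewrite comp_lfunE -wq zero_lfunE => ->.
have [|V [stV eV]] := corner_subquotient (U := fullv) _ (memvf x) nx.
  by move=> *; rewrite memvf.
have [h hh /lfun_neq0[p hp]] := has_eigenform_lift (pair_charP i j) pP eP eV.
exists (sub_incl stV \o h)%VF; first exact: lhom_comp (sub_incl_hom _) hh.
apply: contraNneq hp => /lfunP/(_ p); rewrite comp_lfunE sub_inclE zero_lfunE => z.
by apply/eqP/subvs_inj.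
Qed.

End Top.
End Bimodules.

(** * Bimodules that are projective on the right *)

Section RightProjective.
Variables (k : fieldType) (A : falgType k).
Implicit Types (M P X Y : bimodule A).

Definition rlinear X Y (f : 'Hom(X, Y)) :=
  forall b x, f (lact X (epure 1 b) x) = lact Y (epure 1 b) (f x).

Definition right_projective M :=
  forall X Y (g : 'Hom(X, Y)) (f : 'Hom(M, Y)), rlinear g -> limg g = fullv ->
    rlinear f -> exists2 h : 'Hom(M, X), rlinear h & f = (g \o h)%VF.

Lemma lhom_rlinear X Y (f : 'Hom(X, Y)) : lhom f -> rlinear f.
Proof. by move=> hf b x; rewrite hf. Qed.

Lemma rlinear_comp X Y M (g : 'Hom(Y, M)) (f : 'Hom(X, Y)) :
  rlinear g -> rlinear f -> rlinear (g \o f)%VF.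
Proof. by move=> hg hf b x; rewrite 2!comp_lfunE hf hg. Qed.

Lemma right_projective_regular : right_projective (bregular A).
Proof.
move=> X Y g f hg sg hf.
have [x gx] := surj_preim sg (f 1).
have hl : linear (fun a : A => lact X (epure 1 a) x).
  by move=> c a b; rewrite epure_linr lactPE.
pose h : 'Hom(bregular A, X) := linfun (fun a : A => lact X (epure 1 a) x).
have hE a : h a = lact X (epure 1 a) x by rewrite /h linfunE.
exists h => [b a|].
  by rewrite !hE -lactME epureM mulr1 /= breg_actE mul1r.
apply/lfunP => a; rewrite comp_lfunE hE hg gx -hf; congr (f _).
by rewrite /= breg_actE !mul1r.
Qed.

(** The enveloping algebra is free as a right module, so lifts can be chosen
    freely on the elements [(a (x) 1) q_j]. *)
Lemma projective_right_projective P : projective P -> right_projective P.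
Proof.
move=> pP X Y g f hg sg hf.
have [F [hF pF]] := projective_dual_basis pP.
pose q (j : 'I_(\dim {:P})) : P := (vbasis {:P})`_j.
(* The element [B j a b] is [y b] for a preimage [y] of [f (a q_j)]. *)
pose B j a b : X := lact X (epure 1 b) ((g^-1)%VF (f (lact P (epure a 1) (q j)))).
have Bb j : bilin (B j).
  split=> [b|a] c x y; rewrite /B; last by rewrite epure_linr lactPE.
  by rewrite epure_linl lactPE !linearP.
pose H j : env A -> X := tlift (B j).
have HE j a b : H j (epure a b) = B j a b by apply: tlift_pure.
have Hl j : linear (H j) by apply: tlift_is_linear.
have gH j t : g (H j t) = f (lact P t (q j)).
  move: t; apply: env_eq_lin => [c x y|c x y|a b].
  - by rewrite Hl linearP.
  - by rewrite lactPE linearP.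
  rewrite HE hg limg_lfunVK ?sg ?memvf // -hf.
  by rewrite lact_epureC -lact_epure.
have HM j b t : H j (epure 1 b * t) = lact X (epure 1 b) (H j t).
  move: t; apply: env_eq_lin => [c x y|c x y|a' b'].
  - by rewrite -Hl; congr (H j _); exact: emul_linr.
  - by rewrite Hl linearP.
  by rewrite epureM mul1r !HE /B -lactME epureM mul1r.
pose h p := \sum_j H j (F j p).
have hl : linear h.
  move=> c x y; rewrite /h scaler_sumr -big_split; apply: eq_bigr => j _.
  by rewrite linearP Hl.
exists (linfun h) => [b p|].
  rewrite !linfunE // /h linear_sum; apply: eq_bigr => j _.
  by rewrite hF /= lfunE HM.
apply/lfunP => p; rewrite comp_lfunE linfunE // {1}[p]pF /h !linear_sum.
by apply: eq_bigr => j _; rewrite [RHS]gH.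
Qed.

Lemma cover_retraction M : right_projective M ->
  exists2 r : 'Hom(pcover M, Omega M), rlinear r &
    forall w : Omega M, r (vsval w) = w.
Proof.
move=> rM; set q := pc_map (pcover M).
have hq : lhom q := pc_hom (pcover M).
have sq : limg q = fullv := pc_surj (pcover M).
have [|s hs es] := rM _ _ q \1%VF (lhom_rlinear hq) sq.
  by move=> b x; rewrite !id_lfunE.
have qs m : q (s m) = m by rewrite -comp_lfunE -es id_lfunE.
pose r : 'Hom(pcover M, Omega M) := linfun (vsproj (lker q) \o (\1 - (s \o q))%VF).
have rE p : vsval (r p) = p - s (q p).
  rewrite /r lfunE /= vsprojK ?add_lfunE ?opp_lfunE ?id_lfunE ?comp_lfunE //.
  by rewrite memv_ker linearB /= qs subrr.
exists r => [b p|w]; apply: subvs_inj.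
  apply: esym; apply: (etrans (sub_actE (ker_stable hq) _ (r p))).
  by rewrite !rE hq hs linearB.
have /eqP qw : q (vsval w) == 0 by rewrite -memv_ker subvsP.
by rewrite rE qw linear0 subr0.
Qed.

Lemma right_projective_Omega M : right_projective M -> right_projective (Omega M).
Proof.
move=> rM; have [r hr rK] := cover_retraction rM.
move=> X Y g f hg sg hf.
have [h hh eh] := projective_right_projective (pc_projective (pcover M)) hg sg (rlinear_comp hf hr).
exists (h \o sub_incl (ker_stable (pc_hom (pcover M))))%VF.
  apply: rlinear_comp hh _; apply: lhom_rlinear; exact: sub_incl_hom.
by apply/lfunP => w; rewrite comp_lfunE comp_lfunE -comp_lfunE -eh comp_lfunE sub_inclE rK.
Qed.

Lemma right_projective_syzygy M n : right_projective M -> right_projective (syzygy n M).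
Proof. by move=> rM; elim: n => // n; apply: right_projective_Omega. Qed.

End RightProjective.

(** * Base change along a character of the right action *)

Section Collapse.
Variables (k : fieldType) (A : falgType k) (chi : A -> k).
Hypothesis hchi : character chi.
Implicit Types (M P : bimodule A) (N : lmodule A).

Definition balanced M (V : vectType k) (f : 'Hom(M, V)) :=
  forall b m, f (lact M (epure 1 b) m) = chi b *: f m.

(** A presentation of [N] as [M (x)_A S], for the simple left module [S] given by
    [chi]. Stating it by a universal property avoids carrying isomorphisms from
    one syzygy to the next. *)
Record collapse M N (p : 'Hom(M, N)) : Prop := Collapse {
  collapse_surj : limg p = fullv;
  collapse_act : forall t m, p (lact M t m) = lact N (twist chi t) (p m);
  collapse_univ : forall (V : vectType k) (f : 'Hom(M, V)),
    balanced f -> (lker p <= lker f)%VS }.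

Lemma collapse_balanced M N (p : 'Hom(M, N)) : collapse p -> balanced p.
Proof.
move=> cp b m; rewrite (collapse_act cp) twist_pure // lactZ lact1E //.
Qed.

Section Quotient.
Variable M : bimodule A.

(** The span of all [m b - chi(b) m], with [b] restricted to a basis of [A] so as
    to have a finite sum of subspaces. *)
Definition unbalance : {vspace M} :=
  (\sum_(i < \dim {:A}) limg (lact M (epure 1%R (vbasis {:A})`_i)
     - chi (vbasis {:A})`_i *: \1)%VF)%VS.

Lemma unbalance_mem b m : lact M (epure 1 b) m - chi b *: m \in unbalance.
Proof.
pose f b : M := lact M (epure 1 b) m - chi b *: m.
have fl : linear f.
  move=> c x y; rewrite /f epure_linr lactPE (char_linear hchi).
  by rewrite scalerDl opprD addrACA scalerBr scalerA.
rewrite -[_ - _]/(f b) -(linfunE fl b) (coord_vbasis (memvf b)) linear_sum.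
apply: memv_suml => i _.
rewrite linearZ /= memvZ // linfunE // memvE.
apply: subv_trans (sumv_sup i _ (subvv _)) => //.
rewrite -memvE; apply/memv_imgP; exists m; first exact: memvf.
by rewrite add_lfunE opp_lfunE scale_lfunE id_lfunE.
Qed.

Lemma unbalance_le (V : vectType k) (f : 'Hom(M, V)) : balanced f -> (unbalance <= lker f)%VS.
Proof.
move=> bf; apply/subv_sumP => i _; apply/subvP => _ /memv_imgP[m _ ->].
rewrite memv_ker add_lfunE opp_lfunE scale_lfunE id_lfunE linearB linearZ /=.
by rewrite bf subrr.
Qed.

Lemma unbalance_stable a m : m \in unbalance -> lact M (epure a 1) m \in unbalance.
Proof.
move=> Um; rewrite -[unbalance]lker_qproj memv_ker -comp_lfunE -memv_ker.
apply: subvP m Um; apply: unbalance_le => b m.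
rewrite !comp_lfunE -lact_epureC -linearZ; apply/qprojP; exact: unbalance_mem.
Qed.

Definition collapse_space := quot unbalance.
Definition cact (a : A) : 'End(collapse_space) :=
  (qproj unbalance \o lact M (epure a 1) \o linfun (@vsval k M (unbalance^C)%VS))%VF.

Lemma cactE a m : cact a (qproj unbalance m) = qproj unbalance (lact M (epure a 1) m).
Proof.
rewrite /cact !comp_lfunE lfunE; apply/qprojP; rewrite -linearB.
by apply: unbalance_stable; rewrite -opprB memvN; apply: qreprK.
Qed.
Lemma cact_linear : linear cact.
Proof.
move=> c a b; apply/lfunP => w; rewrite -[w]qprojK.
by rewrite add_lfunE scale_lfunE !cactE epure_linl lactPE linearP.
Qed.
Lemma cact1 : cact 1 = \1%VF.
Proof. by apply/lfunP => w; rewrite -[w]qprojK cactE lact1E id_lfunE. Qed.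
Lemma cactM a b : cact (a * b) = (cact a \o cact b)%VF.
Proof.
by apply/lfunP => w; rewrite -[w]qprojK comp_lfunE !cactE -lactME epureM mulr1.
Qed.
Definition collapse_module : lmodule A := LModule cact_linear cact1 cactM.

Lemma collapse_moduleP : collapse (qproj unbalance : 'Hom(M, collapse_module)).
Proof.
split=> [|t m|V f bf].
- by apply: surj_limg => w; exists (qrepr w); rewrite qprojK.
- move: t; apply: env_eq_lin => [c x y|c x y|a b].
  + by rewrite lactPE linearP.
  + by rewrite twist_linear lactPE.
  rewrite twist_pure // lactZ [in RHS]/= cactE lact_epure -lact_epureC -linearZ.
  by apply/qprojP; apply: unbalance_mem.
by rewrite lker_qproj unbalance_le.
Qed.

End Quotient.

(** Base change along [twist chi] is left adjoint to inflation, which is exact. *)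
Lemma collapse_projective P N (p : 'Hom(P, N)) : collapse p -> projective P -> projective N.
Proof.
move=> cp pP X Y g f hg sg hf.
have hg' : lhom (g : 'Hom(inflate hchi X, inflate hchi Y)) by move=> t x; apply: hg.
have hfp : lhom (f \o p : 'Hom(P, inflate hchi Y))%VF.
  by move=> t x; rewrite !comp_lfunE (collapse_act cp) hf.
have [h hh eh] := pP _ _ _ _ hg' sg hfp.
have bh : balanced (h : 'Hom(P, X)).
  by move=> b m; rewrite hh /= /inflate_act twist_pure // lactZ lact1E.
have hE := factor_surj (collapse_surj cp) (collapse_univ cp bh).
exists (h \o p^-1)%VF => [a n|].
  have [m <-] := surj_preim (collapse_surj cp) n.
  rewrite -{1}[a](twist_left hchi) -(collapse_act cp) !comp_lfunE !hE hh /=.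
  by rewrite /inflate_act twist_left.
apply/lfunP => n; have [m <-] := surj_preim (collapse_surj cp) n.
by rewrite !comp_lfunE hE -[LHS]comp_lfunE eh comp_lfunE.
Qed.

(** Eigenforms for [psi \o twist chi] are balanced, so they factor through [p]. *)
Lemma collapse_eigenform M N (p : 'Hom(M, N)) (psi : A -> k) :
  character psi -> collapse p ->
  has_eigenform (fun t => psi (twist chi t)) M <-> has_eigenform psi N.
Proof.
move=> hpsi cp; have sp := collapse_surj cp.
split=> [[g hg ng]|[g hg ng]].
  have bg : balanced g.
    by move=> b m; rewrite hg twist_epure // char1 // mul1r.
  have gE := factor_surj sp (collapse_univ cp bg).
  exists (g \o p^-1)%VF => [a n|].
    have [m <-] := surj_preim sp n.
    rewrite -{1}[a](twist_left hchi) -(collapse_act cp) !comp_lfunE !gE hg.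
    by rewrite twist_left.
  apply: contraNneq ng => z; apply/eqP/lfunP => m.
  by rewrite -gE -comp_lfunE z !zero_lfunE.
exists (g \o p)%VF => [t m|]; first by rewrite !comp_lfunE (collapse_act cp) hg.
apply: contraNneq ng => z; apply/eqP/lfunP => n.
have [m <-] := surj_preim sp n.
by rewrite -comp_lfunE z !zero_lfunE.
Qed.

End Collapse.

(** * Base change of minimal resolutions *)

Section ProjectiveCovers.
Variables (k : fieldType) (A : falgType k).
Implicit Types N : lmodule A.

Lemma superfluous_surj (X Y Z : lmodule A) (f : 'Hom(X, Y)) (g : 'Hom(Y, Z)) :
  lhom f -> superfluous (lker g) -> (forall y, exists x, g (f x) = g y) ->
  limg f = fullv.
Proof.
move=> hf sg gf; apply: sg; first exact: img_stable.
apply/vspaceP => y; rewrite memvf; have [x gx] := gf y.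
apply/memv_addP; exists (f x); first by rewrite memv_img ?memvf.
exists (y - f x); last by rewrite addrC subrK.
by rewrite memv_ker linearB /= gx subrr.
Qed.

(** Lifts in both directions between two projective covers of [N] are surjective,
    because the kernels are superfluous; one of them splits the other, so both are
    bijective. *)
Lemma proj_cover_iso N (F : lmodule A) (theta : 'Hom(F, N)) :
  projective F -> lhom theta -> limg theta = fullv -> superfluous (lker theta) ->
  exists2 alpha : 'Hom(F, pcover N), lhom alpha /\ limg alpha = fullv &
    lker alpha = 0%VS /\ forall v, pc_map (pcover N) (alpha v) = theta v.
Proof.
move=> pF ht st supt; set q := pc_map (pcover N).
have [al hal eal] := pF _ _ _ _ (pc_hom (pcover N)) (pc_surj (pcover N)) ht.
have qal v : q (al v) = theta v by rewrite -comp_lfunE -eal.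
have sal : limg al = fullv.
  apply: superfluous_surj hal (pc_superfluous (pcover N)) _ => y.
  by have [v ev] := surj_preim st (q y); exists v; rewrite -ev -qal.
have [s hs es] : exists2 s : 'Hom(pcover N, F), lhom s & \1%VF = (al \o s)%VF.
  by apply: (pc_projective (pcover N)) => // a m; rewrite !id_lfunE.
have als v : al (s v) = v by rewrite -comp_lfunE -es id_lfunE.
have ss : limg s = fullv.
  apply: superfluous_surj hs supt _ => v.
  by exists (al v); rewrite -!qal als.
exists al => //; split=> //; apply/eqP; rewrite -subv0; apply/subvP => v.
rewrite memv_ker memv0; have [w <-] := surj_preim ss v.
by rewrite als => /eqP->; rewrite linear0.
Qed.

End ProjectiveCovers.

Section CollapseOmega.
Variables (k : fieldType) (A : falgType k) (chi : A -> k).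
Hypothesis hchi : character chi.
Implicit Types (M : bimodule A) (N : lmodule A).

(** Right exactness of the base change: the quotient of [M] by the image of
    [lker pi] is again balanced, so the universal property of [p] applies to it. *)
Lemma collapse_ker_cover M N (p : 'Hom(M, N)) (P : bimodule A) (F : lmodule A)
    (q : 'Hom(P, M)) (pi : 'Hom(P, F)) :
  collapse chi p -> collapse chi pi -> lhom q -> limg q = fullv ->
  (lker p <= q @: lker pi)%VS.
Proof.
move=> cp cpi hq sq.
rewrite -[(q @: _)%VS]lker_qproj; apply: (collapse_univ cp) => b m.
have [u <-] := surj_preim sq m; apply/eqP.
rewrite -subr_eq0 -hq -linearZ -linearB /= -linearZ -linearB /= -memv_ker lker_qproj.
apply: memv_img; rewrite memv_ker linearB linearZ /=.
by rewrite (collapse_balanced hchi cpi) subrr.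
Qed.

(** Base change preserves projective covers. If [V] together with the kernel of
    [theta] spans [F], then the preimage of [V] together with the kernel of the
    cover of [M] spans [pcover M]. *)
Lemma collapse_cover M N (p : 'Hom(M, N)) (F : lmodule A) (pi : 'Hom(pcover M, F)) :
  collapse chi p -> collapse chi pi ->
  exists2 theta : 'Hom(F, N), lhom theta /\ superfluous (lker theta) &
    forall u, theta (pi u) = p (pc_map (pcover M) u).
Proof.
move=> cp cpi; set q := pc_map (pcover M).
have hq : lhom q := pc_hom (pcover M).
have sq : limg q = fullv := pc_surj (pcover M).
have spi := collapse_surj cpi.
have bpq : balanced chi (p \o q)%VF.
  by move=> b u; rewrite !comp_lfunE hq (collapse_balanced hchi cp).
pose theta := ((p \o q) \o pi^-1)%VF.
have thE u : theta (pi u) = p (q u).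
  by rewrite /theta comp_lfunE (factor_surj spi (collapse_univ cpi bpq)) comp_lfunE.
exists theta => //; split=> [a v|V stV VK].
  have [u <-] := surj_preim spi v.
  rewrite -{1}[a](twist_left hchi) -(collapse_act cpi) !thE hq.
  by rewrite (collapse_act cp) twist_left.
pose V' : {vspace pcover M} := (pi @^-1: V)%VS.
have stV' : lstable V'.
  by move=> t u; rewrite -!memv_preim (collapse_act cpi) => /stV.
have V'full : V' = fullv.
  have sup := pc_superfluous (pcover M); apply: sup => //.
  apply/vspaceP => u; rewrite memvf.
  have /memv_addP[v Vv [z zK eu]] : pi u \in (V + lker theta)%VS by rewrite VK memvf.
  have [u1 eu1] := surj_preim spi v.
  have : q (u - u1) \in lker p.
    rewrite memv_ker -thE linearB /= eu eu1 addrC addKr.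
    by rewrite memv_ker in zK.
  move/(subvP (collapse_ker_cover cp cpi hq sq)) => /memv_imgP[u2].
  rewrite memv_ker => /eqP pu2 qu2.
  apply/memv_addP; exists (u1 + u2).
    by rewrite -memv_preim linearD /= eu1 pu2 addr0.
  exists (u - u1 - u2); last by rewrite -[u - u1 - u2]addrA -opprD [RHS]addrC subrK.
  by rewrite memv_ker linearB /= qu2 subrr.
apply/vspaceP => v; rewrite memvf; have [u <-] := surj_preim spi v.
by have := memvf u; rewrite -V'full -memv_preim.
Qed.

(** With [F] the base change of the cover of [M], the map [F -> N] is a projective
    cover, so [F] is identified with [pcover N] and the map [pcover M -> pcover N]
    restricts to the kernels. This restriction has the universal property because
    a balanced map on [Omega M] extends to [pcover M] along a right linear
    retraction, still balanced. *)
Lemma collapse_Omega M N (p : 'Hom(M, N)) :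
  right_projective M -> collapse chi p ->
  exists p' : 'Hom(Omega M, Omega N), collapse chi p'.
Proof.
move=> rM cp; set q0 := pc_map (pcover M); set q := pc_map (pcover N).
have hq0 : lhom q0 := pc_hom (pcover M).
have sq0 : limg q0 = fullv := pc_surj (pcover M).
have cpi := collapse_moduleP hchi (pcover M).
set pi : 'Hom(pcover M, _) := qproj _ in cpi.
have [theta [ht supt] thE] := collapse_cover cp cpi.
have pF := collapse_projective hchi cpi (pc_projective (pcover M)).
have st : limg theta = fullv.
  apply: surj_limg => n; have [m <-] := surj_preim (collapse_surj cp) n.
  by have [u <-] := surj_preim sq0 m; exists (pi u).
have [al [hal sal] [kal qal]] := proj_cover_iso pF ht st supt.
pose psi : 'Hom(pcover M, pcover N) := (al \o pi)%VF.
have psiE u : q (psi u) = p (q0 u) by rewrite /psi comp_lfunE qal thE.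
have psi0 u : psi u = 0 -> pi u = 0.
  move=> e; apply/eqP; rewrite -memv0 -kal memv_ker.
  by rewrite -[al _]comp_lfunE -/psi e.
have psiS : limg psi = fullv.
  apply: surj_limg => w; have [v <-] := surj_preim sal w.
  have [u <-] := surj_preim (collapse_surj cpi) v.
  by exists u; rewrite /psi comp_lfunE.
have psiA t u : psi (lact (pcover M) t u) = lact (pcover N) (twist chi t) (psi u).
  by rewrite /psi !comp_lfunE (collapse_act cpi) hal.
have psik u : pi u = 0 -> psi u = 0 by rewrite /psi comp_lfunE => ->; rewrite linear0.
clearbody psi.
have kq (w : Omega M) : q0 (vsval w) = 0.
  by apply/eqP; rewrite -memv_ker; apply: subvsP.
pose p' : 'Hom(Omega M, Omega N) :=
  (linfun (vsproj (lker q)) \o psi \o linfun (@vsval k _ (lker q0)))%VF.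
have p'E w : vsval (p' w) = psi (vsval w).
  by rewrite /p' !comp_lfunE !lfunE /= vsprojK // memv_ker psiE kq linear0.
clearbody p'.
exists p'; split=> [|t w|V f bf].
- apply: surj_limg => n; have [u eu] := surj_preim psiS (vsval n).
  have : q0 u \in lker p.
    by rewrite memv_ker -psiE eu -memv_ker; apply: subvsP.
  move/(subvP (collapse_ker_cover cp cpi hq0 sq0)) => /memv_imgP[u2].
  rewrite memv_ker => /eqP pu2 qu2.
  exists (vsproj (lker q0) (u - u2)); apply: subvs_inj.
  rewrite p'E vsprojK; last by rewrite memv_ker linearB /= qu2 subrr.
  by rewrite linearB /= eu (psik u2) ?subr0.
- apply: subvs_inj; rewrite p'E.
  apply: etrans (congr1 psi (sub_actE (ker_stable hq0) t w)) _.
  rewrite psiA -p'E; apply: esym.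
  exact: (sub_actE (ker_stable (pc_hom (pcover N))) (twist chi t) (p' w)).
have [r hr rK] := cover_retraction rM.
apply/subvP => w; rewrite memv_ker => /eqP p'w.
have /psi0 piw : psi (vsval w) = 0 by rewrite -p'E p'w.
have bfr : balanced chi (f \o r)%VF by move=> b u; rewrite !comp_lfunE hr bf.
have /subvP/(_ (vsval w)) := collapse_univ cpi bfr.
rewrite !memv_ker piw eqxx comp_lfunE rK; exact.
Qed.

Lemma collapse_syzygy M N (p : 'Hom(M, N)) n :
  right_projective M -> collapse chi p ->
  exists p' : 'Hom(syzygy n M, syzygy n N), collapse chi p'.
Proof.
move=> rM cp; elim: n => [|n [p' cp']]; first by exists p.
exact: (collapse_Omega (right_projective_syzygy (n:=n) rM) cp').
Qed.

End CollapseOmega.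

(** * Torsion of simple right modules *)

Section TensorSimple.
Variables (k : fieldType) (A : falgType k).

Lemma lin_eq_vbasis (V W : vectType k) (f g : V -> W) : linear f -> linear g ->
  (forall v, v \in vbasis {:V} -> f v = g v) -> f =1 g.
Proof.
move=> fl gl e v; rewrite -(linfunE fl) -(linfunE gl) (coord_vbasis (memvf v)).
rewrite !linear_sum; apply: eq_bigr => i _; rewrite !linearZ /= !linfunE //.
by rewrite e // mem_nth // size_tuple.
Qed.

Lemma tens_relP (R : rmodule A) (N : lmodule A) a r n :
  qproj (tens_rel R N) (tpure (ract R a r) n) = qproj (tens_rel R N) (tpure r (lact N a n)).
Proof.
have [tl tr] := @tpure_bilin k R N.
move: a; apply: lin_eq_vbasis => [c x y|c x y|a ba].
- by rewrite ractPE tl linearP.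
- by rewrite lactPE tr linearP.
move: r; apply: lin_eq_vbasis => [c x y|c x y|r br].
- by rewrite linearP tl linearP.
- by rewrite tl linearP.
move: n; apply: lin_eq_vbasis => [c x y|c x y|n bn].
- by rewrite tr linearP.
- by rewrite linearP tr linearP.
apply/qprojP; rewrite memvE /tens_rel.
rewrite (big_rem a) //= (big_rem r) //= (big_rem n) //=.
by rewrite -!addvA addvSl.
Qed.

Lemma tens_rel_le (R : rmodule A) (N : lmodule A) (W : vectType k)
    (f : 'Hom(tens R N, W)) :
  (forall a r n, f (tpure (ract R a r) n) = f (tpure r (lact N a n))) ->
  (tens_rel R N <= lker f)%VS.
Proof.
move=> hf; pose le (U : {vspace tens R N}) := (U <= lker f)%VS.
have add U V : le U -> le V -> le (U + V)%VS by rewrite /le subv_add => -> ->.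
have zero : le 0%VS by exact: sub0v.
apply: (big_ind le) => // a _; apply: (big_ind le) => // r _.
apply: (big_ind le) => // n _.
by rewrite /le -memvE memv_ker linearB /= hf subrr.
Qed.

Lemma quot_neq0 (V : vectType k) (U : {vspace V}) : U = 0%VS ->
  (exists v : quot U, v != 0) <-> exists v : V, v != 0.
Proof.
move=> U0; split=> [[v nv]|[v nv]].
  exists (qrepr v); apply: contraNneq nv => z.
  by rewrite -[v]qprojK z linear0.
by exists (qproj U v); rewrite -memv_ker lker_qproj U0 memv0.
Qed.

Lemma homology0_neq0 (U V W : vectType k) (f : 'Hom(U, V)) (g : 'Hom(V, W)) :
  f = 0 -> g = 0 -> (exists v : homology f g, v != 0) <-> exists v : V, v != 0.
Proof.
move=> f0 g0.
have gfull v : v \in lker g by rewrite memv_ker g0 zero_lfunE.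
rewrite /homology; set K := (_ @^-1: _)%VS.
have K0 : K = 0%VS.
  apply/eqP; rewrite -subv0; apply/subvP => w; rewrite -memv_preim.
  case/memv_imgP => u _; rewrite f0 zero_lfunE lfunE memv0 => z.
  by apply/eqP/subvs_inj; rewrite z linear0.
apply: (iff_trans (quot_neq0 K0)); split=> [[v nv]|[v nv]].
  exists (vsval v); apply: contraNneq nv => z.
  by apply/eqP/subvs_inj; rewrite z linear0.
exists (vsproj (lker g) v); apply: contraNneq nv => z.
by rewrite -(vsprojK (gfull v)) z linear0.
Qed.

(* The right module [R] is the one-dimensional module given by [chi]. *)
Variables (R : rmodule A) (chi : A -> k).
Variable (one : R).
Hypothesis one_gen : forall r : R, exists d : k, r = d *: one.
Hypothesis one_neq0 : one != 0.
Hypothesis actR : forall a r, ract R a r = chi a *: r.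

Lemma tens_form_eigenform (N : lmodule A) (l : 'Hom(tensA R N, k^o)) :
  exists2 g : 'Hom(N, k^o), eigenform chi g &
    forall n, g n = l (qproj (tens_rel R N) (tpure one n)).
Proof.
have [tl tr] := @tpure_bilin k R N.
pose g n : k^o := l (qproj (tens_rel R N) (tpure one n)).
have gl : linear g by move=> c x y; rewrite /g tr !linearP.
exists (linfun g) => [a n|n]; rewrite !linfunE // /g -tens_relP actR.
have := tl n (chi a) one 0; rewrite addr0 => ->.
have -> : tpure (0 : R) n = 0 by apply/matrixP => i j; rewrite !mxE linear0 mul0r.
by rewrite addr0 !linearZ.
Qed.

Lemma tpureZl (V W : vectType k) d (v : V) (w : W) : tpure (d *: v) w = d *: tpure v w.
Proof. by apply/matrixP => i j; rewrite !mxE linearZ /= mulrA. Qed.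

Lemma tensA_neq0 (N : lmodule A) :
  (exists t : tensA R N, t != 0) <-> has_eigenform chi N.
Proof.
split=> [[t /form_neq0[l lt]]|[g hg /lfun_neq0[n gn]]].
  have [g hg gE] := tens_form_eigenform l.
  exists g => //; apply: contraNneq lt => g0.
  rewrite -[t]qprojK; move: (qrepr t) => s.
  suff -> : l (qproj (tens_rel R N) s) = 0 by [].
  move: s; apply: (tens_eq_lin (W := k^o) (g := fun _ => 0)).
  - by move=> c x y; rewrite !linearP.
  - by move=> c x y; rewrite scaler0 addr0.
  move=> r n; have [d ->] := one_gen r.
  by rewrite tpureZl !linearZ /= -gE g0 zero_lfunE scaler0.
have [l lone] := form_neq0 one_neq0.
pose b r n : k^o := (l r : k) * g n.
have bb : bilin b.
  split=> [v|u] c x y; rewrite /b linearP.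
    by rewrite mulrDl; congr (_ + _); exact/esym/mulrA.
  by rewrite mulrDr; congr (_ + _); exact: mulrCA.
pose G : 'Hom(tens R N, k^o) := linfun (tlift b).
have GE r m : G (tpure r m) = b r m by rewrite /G lfunE /= tlift_pure.
have kG : (tens_rel R N <= lker G)%VS.
  apply: tens_rel_le => a r m; rewrite !GE /b actR hg.
  rewrite [LHS](_ : _ = chi a * l r * g m) //; last by rewrite linearZ.
  by rewrite -mulrA mulrCA.
exists (qproj (tens_rel R N) (tpure one n)); rewrite -memv_ker lker_qproj.
apply/negP => /(subvP kG); rewrite memv_ker GE /b mulf_eq0.
by rewrite (negbTE lone) (negbTE gn).
Qed.

(** Minimality of the resolution: if the class of [one (x) w] were nonzero for
    some [w] in the superfluous kernel of the cover, a form detecting it would give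
    an eigenform not vanishing at [w]. *)
Lemma tensA_pres_map0 (N : lmodule A) : tensA_map R (pres_map N) = 0.
Proof.
have key w : w \in lker (pc_map (pcover N)) ->
    qproj (tens_rel R (pcover N)) (tpure one w) = 0.
  move=> kw; apply/eqP/negPn/negP => /form_neq0[l]; apply/negP/negPn/eqP.
  have [g hg <-] := tens_form_eigenform l.
  exact: eigenform_superfluous hg (pc_superfluous (pcover N)) kw.
have [tl tr] := @tpure_bilin k R (pcover N).
have bb : bilin (fun (r : R) m => tpure r (pres_map N m) : tens R (pcover N)).
  by split=> [m|r] c x y; rewrite ?tl // linearP tr.
apply/lfunP => t; rewrite zero_lfunE /tensA_map !comp_lfunE; move: (linfun _ t) => s.
move: s; apply: (tens_eq_lin (g := fun _ => 0)).
- by move=> c x y; rewrite !linearP.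
- by move=> c x y; rewrite scaler0 addr0.
move=> r m; rewrite lfunE /= tlift_pure //.
have [d ->] := one_gen r; rewrite tpureZl linearZ /= key ?scaler0 //.
by rewrite /pres_map comp_lfunE sub_inclE subvsP.
Qed.

Lemma Tor_neq0 (N : lmodule A) n :
  (exists t : Tor R N n, t != 0) <-> has_eigenform chi (syzygy n N).
Proof.
apply: (iff_trans _ (has_eigenform_pcover chi (syzygy n N))).
apply: (iff_trans _ (tensA_neq0 _)).
case: n => [|n].
  by apply: quot_neq0; rewrite tensA_pres_map0 lim0g.
by apply: homology0_neq0; apply: tensA_pres_map0.
Qed.

End TensorSimple.

(** * Bound quiver algebras *)

Definition infinitely_often (P : nat -> Prop) := forall N, exists2 n, (N <= n)%N & P n.

Lemma infinitely_often_pigeonhole (J : finType) (P : J -> nat -> Prop) :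
  infinitely_often (fun n => exists j, P j n) -> exists j, infinitely_often (P j).
Proof.
move=> infP; apply: boolp.contrapT => no.
have bound j : exists N, forall n, (N <= n)%N -> ~ P j n.
  apply: boolp.contrapT => nb; apply: no; exists j => N.
  apply: boolp.contrapT => nn; apply: nb; exists N => n leNn Pn.
  by apply: nn; exists n.
have [b bP] := boolp.choice bound.
have [n len [j]] := infP (\max_j b j).
by apply: bP; apply: leq_trans len; apply: leq_bigmax.
Qed.

Section BoundQuiver.
Variables (k : fieldType) (Q : quiver) (I : path_algebra k Q -> Prop).
Variable L : bound_quiver_algebra I.

Lemma vertex_char_character x : character (@vertex_char k Q I L x).
Proof.
split; [exact: vertex_char_linear | exact: vertex_char1 | exact: vertex_charM].
Qed.

Lemma path_length0 (p : qpath Q) : path_length p = 0%N -> p = trivial_path (path_start p).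
Proof.
move=> /size0nil p0; apply/val_inj => /=.
by rewrite [LHS]surjective_pairing -[(val p).2]/(path_arrows p) p0.
Qed.

Lemma bound_quiver_elementary :
  elementary (@vertex_char k Q I L) (vertex_idem L).
Proof.
split.
- exact: vertex_char_character.
- move=> x y; rewrite vertex_charE pa_coefE; congr (nat_of_bool _)%:R.
  by apply/eqP/eqP => [/(congr1 (@path_start Q))|->].
- by rewrite -(rmorph1 (bqa_proj L)) -[1]/(pa_one k Q) rmorph_sum.
- move=> x; rewrite /vertex_idem -rmorphM; congr (bqa_proj L _).
  by rewrite -[LHS]/(pa_mul _ _) pa_mul_path trivial_comp eqxx.
have [idI [m _ Fm] _] := bqa_admissible L.
exists m => s sz ks.
pose lift (a : L) := projT1 (boolp.cid (bqa_surj a)).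
have liftK a : bqa_proj L (lift a) = a by rewrite /lift; case: boolp.cid.
have szl : size (map lift s) == m by rewrite size_map sz.
have -> : \prod_(a <- s) a = bqa_proj L (\prod_(v <- map lift s) v).
  by rewrite rmorph_prod big_map; apply: eq_bigr => a _; rewrite liftK.
apply/bqa_ker/Fm; exists [:: Tuple szl]; split; last by rewrite big_seq1.
move=> t; rewrite inE => /eqP -> _ /mapP[a sa ->] p; rewrite lt0n.
apply: contra => /eqP /path_length0 ->.
by rewrite -(vertex_charE L) liftK ks.
Qed.

Lemma Tor_simple_neq0 y (N : lmodule L) n :
  (exists t : Tor (right_simple L y) N n, t != 0) <->
  has_eigenform (@vertex_char k Q I L y) (syzygy n N).
Proof.
apply: (Tor_neq0 (R := right_simple L y) (one := (1 : k^o))) => [r||a r].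
- by exists (r : k); rewrite -[RHS]/(_ * _) mulr1.
- exact: oner_neq0.
by rewrite /= /simple_act scale_lfunE id_lfunE.
Qed.

(** The tensor product of the regular bimodule with a left module is that module;
    a balanced map kills the kernel of the character, being determined by its
    value at 1. *)
Lemma collapse_regular x :
  collapse (@vertex_char k Q I L x)
    (linfun (@vertex_char k Q I L x : L -> k^o) : 'Hom(bregular L, left_simple L x)).
Proof.
have cl := @vertex_char_linear k Q I L x; have hc := vertex_char_character x.
set p := linfun _; have pE (a : L) : p a = vertex_char x a by rewrite /p linfunE.
clearbody p; split=> [|t a|V f bf].
- apply: surj_limg => d; exists ((d : k) *: 1).
  by rewrite [LHS]pE charZ // char1 // mulr1.
- move: t; apply: env_eq_lin => [c s t|c s t|b d].
  + by rewrite lactPE linearP.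
  + by rewrite twist_linear lactPE.
  rewrite twist_pure // /= /simple_act scale_lfunE id_lfunE breg_actE !pE.
  by rewrite !(charM hc) (charZ hc) -[RHS]/(_ * _) [LHS]mulrC -mulrA.
apply/subvP => a; rewrite !memv_ker pE => /eqP xa.
have := bf a 1; rewrite /= breg_actE !mul1r => ->.
by rewrite xa scale0r.
Qed.

Lemma projective_term_eigenform y x n :
  has_eigenform (pair_char (@vertex_char k Q I L) y x) (pcover (syzygy n (bregular L))) <->
  exists t : Tor (right_simple L y) (left_simple L x) n, t != 0.
Proof.
have [hy hx] := (vertex_char_character y, vertex_char_character x).
apply: (iff_trans (has_eigenform_pcover _ _)).
have [p cp] := collapse_syzygy hx n (@right_projective_regular _ _) (collapse_regular x).
apply: (iff_trans (collapse_eigenform hx hy cp)).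
by split=> /Tor_simple_neq0.
Qed.

(** The common form of the two equivalences; the regular bimodule and its dual
    are the values of [X] of interest. *)
Lemma infinite_hom_tau (X : bimodule L) :
  infinitely_often (fun n => exists2 f : 'Hom(X, tau (syzygy n (bregular L))),
                     lhom f & f != 0) <->
  exists y x, (exists v, lact X (epure (vertex_idem L y) (vertex_idem L x)) v != 0) /\
    infinite_graded (Tor (right_simple L y) (left_simple L x)).
Proof.
pose K n := exists2 h : 'Hom(pcover (syzygy n (bregular L)), X), lhom h & h != 0.
have KP n := projective_hom_corner bound_quiver_elementary X
  (pc_projective (pcover (syzygy n (bregular L)))).
transitivity (infinitely_often K).
  split=> inf N.
    have [n len [f hf nf]] := inf N.
    by exists n.+1; [exact: leqW | exact: hom_tau_neq0_hom hf nf].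
  have [[|[|n]] //] := inf N.+2; rewrite !ltnS => len [h hh nh].
  have [T|T] := hom_tau_neq0_consecutive hh nh; first by exists n.
  by exists n.+1; first exact: leqW.
split=> [inf|[y [x [nv inf]]] N].
  have [|[y x] inf'] := @infinitely_often_pigeonhole (vertex Q * vertex Q)%type
    (fun yx n => (exists v, lact X (epure (vertex_idem L yx.1) (vertex_idem L yx.2)) v != 0)
       /\ exists t : Tor (right_simple L yx.1) (left_simple L yx.2) n, t != 0).
    move=> N; have [n len /KP[y [x [nv /projective_term_eigenform nT]]]] := inf N.
    by exists n => //; exists (y, x).
  exists y, x; split; first by have [n _ []] := inf' 0%N.
  by move=> N; have [n len []] := inf' N; exists n.
have [n len nT] := inf N; exists n => //; apply/KP; exists y, x; split=> //.
exact/projective_term_eigenform.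
Qed.

Lemma Hom_space_neq0 (X Y : bimodule L) :
  (exists v : Hom_space X Y, v != 0) <-> exists2 f : 'Hom(X, Y), lhom f & f != 0.
Proof.
split=> [[v nv]|[f /lhomsP hf nf]].
  exists (vsval v); first exact/lhomsP/subvsP.
  by apply: contraNneq nv => z; apply/eqP/subvs_inj; rewrite z linear0.
exists (vsproj (lhoms X Y) f).
by apply: contraNneq nf => z; rewrite -(vsprojK hf) z linear0.
Qed.

Lemma dualsp_neq0 (V : vectType k) :
  (exists f : dualsp V, f != 0) <-> exists v : V, v != 0.
Proof.
split=> [[f /lfun_neq0[v fv]]|[v /form_neq0[l lv]]].
  by exists v; apply: contraNneq fv => ->; rewrite linear0.
by exists l; apply: contraNneq lv => ->; rewrite zero_lfunE.
Qed.

Lemma corner_regular y x : corner_neq0 L y x <->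
  exists a : bregular L, lact (bregular L) (epure (vertex_idem L y) (vertex_idem L x)) a != 0.
Proof. by split=> -[a na]; exists a; move: na; rewrite /= breg_actE. Qed.

Lemma corner_dual_regular y x : corner_neq0 L y x <->
  exists f : bdual (bregular L),
    lact (bdual (bregular L)) (epure (vertex_idem L x) (vertex_idem L y)) f != 0.
Proof.
set t := epure _ _.
have tE f a : (lact (bdual (bregular L)) t f : 'Hom(L, k^o)) a =
    (f : 'Hom(L, k^o)) (vertex_idem L y * a * vertex_idem L x).
  by rewrite [LHS](bdual_actE (X := bregular L)) eswap_pure /= breg_actE.
split=> [[a /form_neq0[f fa]]|[f /lfun_neq0[a fa]]].
  by exists f; apply: contraNneq fa => z; rewrite -tE z zero_lfunE.
by exists a; apply: contraNneq fa => z; rewrite tE z linear0.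
Qed.

Lemma infinite_gradedP (V : nat -> vectType k) (P : nat -> Prop) :
  (forall n, (exists v : V n, v != 0) <-> P n) ->
  infinite_graded V <-> infinitely_often P.
Proof. by move=> VP; split=> inf N; have [n len /VP vn] := inf N; exists n. Qed.

End BoundQuiver.

Theorem theorem5p5 (k : fieldType) (Q : quiver) (I : path_algebra k Q -> Prop)
    (Lambda : bound_quiver_algebra I) :
  (infinite_coplus_gldim Lambda <->
     infinite_graded (fun n : nat => HH_tau_coh (bregular Lambda) n.+1))
  /\
  (infinite_plus_gldim Lambda <->
     infinite_graded (fun n : nat => HH_tau_hom (bregular Lambda) n.+1)).
Proof.
split; apply: iff_sym.
  apply: iff_trans (infinite_gradedP (fun n => iff_trans (dualsp_neq0 _) (Hom_space_neq0 _ _))) _.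
  apply: iff_trans (infinite_hom_tau _) _.
  by split=> -[y [x [/corner_regular nyx inf]]]; exists y, x.
apply: iff_trans (infinite_gradedP (fun n => Hom_space_neq0 _ _)) _.
apply: iff_trans (infinite_hom_tau _) _.
by split=> -[y [x [/corner_dual_regular nyx inf]]]; exists x, y.
Qed.
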